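(* Let $N_H\ge3$ and $k\ge0$ be integers and let $(C_{n,h},E_{N_H,h},\Phi_{N_H,h})$ be a solution on $[0,\infty)$ of the semi-discrete discontinuous Galerkin/Hermite scheme for the Vlasov equation coupled with the local discontinuous Galerkin approximation of the Poisson equation given in the context. Let $f_{N_H,N_x}(t,x,v)=\sum_{n=0}^{N_H-1}C_{n,h}(t,x)\Psi_n(t,v)$. Then: (1) Mass is conserved: $\frac{d}{dt}\int_0^LC_{0,h}\,dx=0$. (2) Assuming that $\|f_{N_H,N_x}(0)\|_{\omega(0)}<+\infty$, $$\|f_{N_H,N_x}(t)\|_{\omega(t)}\le\|f_{N_H,N_x}(0)\|_{\omega(0)}\,e^{t/(4\gamma)},\qquad\forall t\ge0.$$ (3) The discrete total energy $$\mathcal{E}_{N_H,h}(t)=\frac12\int_0^L\left(\frac1{\alpha^2}\left(\sqrt2\,C_{2,h}+C_{0,h}\right)+|E_{N_H,h}|^2\right)dx+\frac12\,\beta\sum_j[\Phi_{N_H,h}]_{j-\frac12}^2$$ is preserved with respect to time.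
   Context: Let $L>0$, $\alpha_0>0$, $\gamma>0$; all functions are real-valued. Let $0=x_{\frac12}<x_{\frac32}<\dots<x_{N_x+\frac12}=L$ be a partition of $[0,L]$ with cells $I_i=[x_{i-\frac12},x_{i+\frac12}]$ of length $h_i$, $h=\max_ih_i$, and $$V_h^k=\{u\in L^2(0,L):\ u|_{I_i}\in P_k(I_i)\ \forall i\},$$ where $P_k(I)$ is the set of polynomials of degree at most $k$ on $I$. Periodic boundary conditions are used (the points $0$ and $L$ are identified when taking one-sided limits). With $u^\pm_{i+\frac12}=\lim_{\Delta x\to0^\pm}u(x_{i+\frac12}+\Delta x)$, jumps and averages are $[u]_{i+\frac12}=u^+_{i+\frac12}-u^-_{i+\frac12}$ and $\{u\}_{i+\frac12}=\frac12(u^+_{i+\frac12}+u^-_{i+\frac12})$. Sums over $j$ run over $j=1,\dots,N_x$. Hermite polynomials: $H_{-1}=0$, $H_0=1$, $\sqrt n\,H_n(\xi)=\xi H_{n-1}(\xi)-\sqrt{n-1}\,H_{n-2}(\xi)$ for $n\ge1$. Basis functions: $\Psi_n(t,v)=\alpha(t)\,H_n(\alpha(t)v)\,\frac{e^{-(\alpha(t)v)^2/2}}{\sqrt{2\pi}}$, with scaling function $$\alpha(t)=\alpha_0\left(1+\gamma\,\alpha_0^2\int_0^t\|E_{N_H,h}(s)\|_\infty^2\,ds\right)^{-1/2},$$ so $\alpha(0)=\alpha_0$ and $\alpha'=-\frac\gamma2\|E_{N_H,h}(t)\|_\infty^2\alpha^3$; $\|\cdot\|_\infty$ is the sup norm in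 $x$. Weight and norm: $\omega(t,v)=\sqrt{2\pi}\,e^{(\alpha(t)v)^2/2}$ and $\|u\|_{\omega(t)}^2=\int_0^L\int_{\mathbb{R}}|u(x,v)|^2\omega(t,v)\,dv\,dx$; equivalently $\|f_{N_H,N_x}(t)\|_{\omega(t)}^2=\sum_{n=0}^{N_H-1}\alpha(t)\int_0^LC_{n,h}^2(t,x)\,dx$. DG scheme for the Vlasov equation: $C_{n,h}(t,\cdot)\in V_h^k$, with the convention $C_{n,h}=0$ for $n<0$ and for $n\ge N_H$, such that for all $\varphi_n\in V_h^k$, all $j$ and $0\le n\le N_H-1$, $$\frac{d}{dt}\int_{I_j}C_{n,h}\varphi_n\,dx-\frac{\alpha'}{\alpha}\int_{I_j}\left(nC_{n,h}+\sqrt{(n-1)n}\,C_{n-2,h}\right)\varphi_n\,dx+a_n^j(g_n,\varphi_n)-\alpha\sqrt n\int_{I_j}E_{N_H,h}C_{n-1,h}\varphi_n\,dx=0,$$ where $$a_n^j(g_n,\varphi_n)=-\int_{I_j}g_n\varphi_n'\,dx+\hat g_{n,j+\frac12}\varphi^-_{n,j+\frac12}-\hat g_{n,j-\frac12}\varphi^+_{n,j-\frac12},\qquad g_n=\frac1\alpha\left(\sqrt{n+1}\,C_{n+1,h}+\sqrt n\,C_{n-1,h}\right),$$ with numerical flux $\hat g_n=\frac12\left[g_n^-+g_n^+-\delta_n(C_{n,h}^+-C_{n,h}^-)\right]$, $\delta_0=0$ and $\delta_n=\sqrt{N_H}/\alpha(t)$ for $1\le n\le N_H-1$. Local DG approximation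 of the Poisson equation: $\Phi_{N_H,h}(t,\cdot),E_{N_H,h}(t,\cdot)\in V_h^k$ such that for all $\eta,\zeta\in V_h^k$ and all $j$ (dropping the indices $N_H,h$ on $\Phi$ and $E$), $$\int_{I_j}\Phi\,\eta'\,dx-\hat\Phi_{j+\frac12}\eta^-_{j+\frac12}+\hat\Phi_{j-\frac12}\eta^+_{j-\frac12}=\int_{I_j}E\,\eta\,dx,$$ $$-\int_{I_j}E\,\zeta'\,dx+\hat E_{j+\frac12}\zeta^-_{j+\frac12}-\hat E_{j-\frac12}\zeta^+_{j-\frac12}=\int_{I_j}(C_{0,h}-\rho_0)\,\zeta\,dx,$$ with fluxes $\hat\Phi=\{\Phi\}$ and $\hat E=\{E\}-\beta[\Phi]$, where $\beta$ is either a positive constant or a positive constant times $1/h$, and $\rho_0$ is the constant with $\int_0^L(C_{0,h}-\rho_0)\,dx=0$. The functions $C_{n,h}$, $E_{N_H,h}$, $\Phi_{N_H,h}$ are continuously differentiable in time. *)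

(* Defs.v *)
From HB Require Import structures.
From mathcomp Require Import all_boot all_order all_algebra.
From mathcomp Require Import all_classical all_reals all_analysis.

Set Implicit Arguments.
Unset Strict Implicit.
Unset Printing Implicit Defensive.

Import Order.TTheory GRing.Theory Num.Theory.
Import numFieldNormedType.Exports.

Local Open Scope classical_set_scope.
Local Open Scope ring_scope.

Section TimeDerivative.
Context {R : realType}.
Implicit Types (f : R -> R) (t : R).

(* Differentiation on the time interval [0, +oo[: the difference quotient is
   taken along s >= 0 only, so that the derivative at t = 0 is one-sided. *)
Definition time_quotient f t (s : R) : R := (f s - f t) / (s - t).

Definition time_derivable f t : Prop :=
  cvg (time_quotient f t @ within [set s | 0 <= s] t^').

Definition ddt f t : R := lim (time_quotient f t @ within [set s | 0 <= s] t^').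

Definition time_C1 f : Prop :=
  (forall t, 0 <= t -> time_derivable f t) /\
  {within [set t | 0 <= t], continuous (ddt f)}.

End TimeDerivative.

Section Mesh.
Context {R : realType}.

(* [xh m] is the node x_{m+1/2}, for 0 <= m <= Nx; the cells are numbered from
   0, so the j-th one, j < Nx, is [xh j, xh j.+1]. Values of [xh] beyond Nx are
   not used. *)
Definition is_mesh (L : R) (Nx : nat) (xh : nat -> R) : Prop :=
  [/\ xh 0%N = 0, xh Nx = L &
      forall j, (j < Nx)%N -> xh j < xh j.+1].

Definition mesh_size (Nx : nat) (xh : nat -> R) : R :=
  \big[Num.max/0]_(j < Nx) (xh j.+1 - xh j).

Definition cell (xh : nat -> R) (j : nat) : set R := `[xh j, xh j.+1]%classic.
Definition cell_interior (xh : nat -> R) (j : nat) : set R :=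
  `]xh j, xh j.+1[%classic.

(* V_h^k. As elements of L^2(0, L), its members have no prescribed value at the
   nodes: only the restrictions to the cell interiors are constrained (two
   polynomials on adjacent closed cells need not agree at the common node). *)
Definition Vh (Nx : nat) (xh : nat -> R) (k : nat) : set (R -> R) :=
  [set u | forall j, (j < Nx)%N ->
     exists2 p : {poly R}, (size p <= k.+1)%N &
       forall x, x \in cell_interior xh j -> u x = p.[x]].

(* Sup norm of an element of V_h^k, again ignoring the values at the nodes. *)
Definition supnorm (Nx : nat) (xh : nat -> R) (u : R -> R) : R :=
  sup [set `|u x| | x in \bigcup_(j in `I_Nx) cell_interior xh j].

(* One-sided limits at the node [xh m], 0 <= m <= Nx, with the points
   xh 0 = 0 and xh Nx = L identified. *)
Definition tr_minus (Nx : nat) (xh : nat -> R) (u : R -> R) (m : nat) : R :=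
  lim (u @ (xh (if m == 0%N then Nx else m))^'-).
Definition tr_plus (Nx : nat) (xh : nat -> R) (u : R -> R) (m : nat) : R :=
  lim (u @ (xh (if m == Nx then 0%N else m))^'+).

Definition jump Nx xh u m : R := tr_plus Nx xh u m - tr_minus Nx xh u m.
Definition avg Nx xh u m : R :=
  2^-1 * (tr_plus Nx xh u m + tr_minus Nx xh u m).

End Mesh.

Section Hermite.
Context {R : realType}.
Local Notation mu := (@lebesgue_measure R).

(* Normalised Hermite polynomials; the inner default branch is H_{-1} = 0. *)
Fixpoint hermite (n : nat) (xi : R) : R :=
  if n is m.+1 then
    (xi * hermite m xi
       - Num.sqrt m%:R * (if m is l.+1 then hermite l xi else 0))
    / Num.sqrt m.+1%:R
  else 1.

(* In the next three definitions [a] stands for the value alpha(t). *)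
Definition Psi (n : nat) (a v : R) : R :=
  a * hermite n (a * v) * (expR (- ((a * v) ^+ 2 / 2)) / Num.sqrt (2 * pi)).

Definition omega (a v : R) : R := Num.sqrt (2 * pi) * expR ((a * v) ^+ 2 / 2).

Definition omega_norm (L a : R) (u : R -> R -> R) : \bar R :=
  ((\int[mu]_(x in `[0%R, L]) \int[mu]_v (`|u x v| ^+ 2 * omega a v)%:E)
     `^ (2^-1)%R)%E.

Definition scaling (alpha0 gamma : R) (normE : R -> R) (t : R) : R :=
  alpha0 *
  (1 + gamma * alpha0 ^+ 2 * \int[mu]_(s in `[0, t]) (normE s ^+ 2))
    `^ (- 2^-1).

End Hermite.

Section Scheme.
Context {R : realType}.
Local Notation mu := (@lebesgue_measure R).
Variables (L : R) (Nx : nat) (xh : nat -> R) (NH k : nat).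
Variables (alpha0 gamma beta : R).
Variables (C : nat -> R -> R -> R) (E Phi : R -> R -> R) (rho0 : R -> R).

Definition alpha : R -> R :=
  scaling alpha0 gamma (fun s => supnorm Nx xh (E s)).

(* For n = 0 the truncated index n - 1 is harmless: its coefficient vanishes,
   in agreement with the convention C_{-1} = 0. The same remark applies to the
   indices n - 1 and n - 2 in [vlasov_eq]. *)
Definition flux_fun (n : nat) (t x : R) : R :=
  (alpha t)^-1 *
  (Num.sqrt n.+1%:R * C n.+1 t x + Num.sqrt n%:R * C (n - 1)%N t x).

Definition delta (n : nat) (t : R) : R :=
  if n == 0%N then 0 else Num.sqrt NH%:R / alpha t.

Definition num_flux (n : nat) (t : R) (m : nat) : R :=
  2^-1 * (tr_minus Nx xh (flux_fun n t) m + tr_plus Nx xh (flux_fun n t) m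
          - delta n t * (tr_plus Nx xh (C n t) m - tr_minus Nx xh (C n t) m)).

Definition dg_form (n : nat) (t : R) (j : nat) (phi : R -> R) : R :=
  - (\int[mu]_(x in cell xh j) (flux_fun n t x * derive1 phi x))
  + num_flux n t j.+1 * tr_minus Nx xh phi j.+1
  - num_flux n t j * tr_plus Nx xh phi j.

Definition vlasov_eq (n : nat) (t : R) (j : nat) (phi : R -> R) : Prop :=
  ddt (fun s => \int[mu]_(x in cell xh j) (C n s x * phi x)) t
  - ddt alpha t / alpha t *
      \int[mu]_(x in cell xh j)
        ((n%:R * C n t x
          + Num.sqrt ((n%:R - 1) * n%:R) * C (n - 2)%N t x) * phi x)
  + dg_form n t j phi
  - alpha t * Num.sqrt n%:R *
      \int[mu]_(x in cell xh j) (E t x * C (n - 1)%N t x * phi x) = 0.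

Definition Phi_flux (t : R) (m : nat) : R := avg Nx xh (Phi t) m.
Definition E_flux (t : R) (m : nat) : R :=
  avg Nx xh (E t) m - beta * jump Nx xh (Phi t) m.

Definition potential_eq (t : R) (j : nat) (eta : R -> R) : Prop :=
  \int[mu]_(x in cell xh j) (Phi t x * derive1 eta x)
  - Phi_flux t j.+1 * tr_minus Nx xh eta j.+1
  + Phi_flux t j * tr_plus Nx xh eta j
  = \int[mu]_(x in cell xh j) (E t x * eta x).

Definition gauss_eq (t : R) (j : nat) (zeta : R -> R) : Prop :=
  - (\int[mu]_(x in cell xh j) (E t x * derive1 zeta x))
  + E_flux t j.+1 * tr_minus Nx xh zeta j.+1
  - E_flux t j * tr_plus Nx xh zeta j
  = \int[mu]_(x in cell xh j) ((C 0%N t x - rho0 t) * zeta x).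

(* V_h^k being finite-dimensional, regularity of a curve in V_h^k amounts to
   regularity of its values at each point of the cell interiors. *)
Definition C1_curve (u : R -> R -> R) : Prop :=
  (forall t, 0 <= t -> Vh Nx xh k (u t)) /\
  (forall j x, (j < Nx)%N -> x \in cell_interior xh j ->
     time_C1 (fun t => u t x)).

(* rho0 is constant in x. That its value does not depend on time either is not
   assumed, since it is a consequence of the conservation of mass. *)
Record dg_solution : Prop := DGSolution {
  sol_C : forall n, (n < NH)%N -> C1_curve (C n);
  sol_trunc : forall n t x, (NH <= n)%N -> C n t x = 0;
  sol_E : C1_curve E;
  sol_Phi : C1_curve Phi;
  sol_rho0 : forall t, 0 <= t ->
    \int[mu]_(x in `[0, L]) (C 0%N t x - rho0 t) = 0;
  sol_vlasov : forall n t j phi, (n < NH)%N -> 0 <= t -> (j < Nx)%N ->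
    Vh Nx xh k phi -> vlasov_eq n t j phi;
  sol_potential : forall t j eta, 0 <= t -> (j < Nx)%N ->
    Vh Nx xh k eta -> potential_eq t j eta;
  sol_gauss : forall t j zeta, 0 <= t -> (j < Nx)%N ->
    Vh Nx xh k zeta -> gauss_eq t j zeta }.

Definition f_approx (t x v : R) : R :=
  \sum_(n < NH) C n t x * Psi n (alpha t) v.

Definition mass (t : R) : R := \int[mu]_(x in `[0, L]) C 0%N t x.

Definition total_energy (t : R) : R :=
  2^-1 * \int[mu]_(x in `[0, L])
           ((alpha t ^+ 2)^-1 * (Num.sqrt 2 * C 2%N t x + C 0%N t x)
            + `|E t x| ^+ 2)
  + 2^-1 * beta * \sum_(j < Nx) jump Nx xh (Phi t) j ^+ 2.

End Scheme.

(* Main.v *)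
(* On each cell the unknowns are polynomials whose coefficients, by Lagrange
   interpolation at fixed sample points, are fixed linear combinations of
   C^1 functions of time. Summing the weak forms over the cells turns the
   scheme into identities for the central-flux form
   B(p, q) = - sum_j int_{I_j} p q' - sum_j {p}_j [q]_j, which is antisymmetric
   by integration by parts.
   (1) follows from the test function 1.
   (3) The choices C_1 and dE/dt in the potential equation, Phi in the
   time-differentiated Gauss equation and in the equation for C_0 express
   everything through int E C_1, which also drives the second moment.
   (2) Parseval for the Hermite functions identifies the norm with
   modal_norm = alpha sum_n int C_n^2. The transport terms cancel by antisymmetry, the
   penalization has a sign, and with D_n = sqrt n C_n + sqrt (n-1) C_{n-2}, the
   remaining terms are sum_n int (alpha' D_n^2 + alpha^2 E D_n C_{n-1}). The
   choice alpha' = - (gamma/2) |E|_oo^2 alpha^3 lets Young's inequality absorb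
   D_n, so that S' <= modal_norm / (2 gamma). *)

Require Import Defs.
From HB Require Import structures.
From mathcomp Require Import all_boot all_order all_algebra.
From mathcomp Require Import ring lra.
From mathcomp Require Import all_classical all_reals all_analysis.
From mathcomp Require Import measurable_realfun.

Import Order.TTheory GRing.Theory Num.Theory.
Import numFieldNormedType.Exports.

Local Open Scope classical_set_scope.
Local Open Scope ring_scope.

(** * Differentiation on [0, +oo[ *)

(** Two obstacles shape the proof. Members of V_h have no values at the nodes, so each unknown is
    replaced by a family of polynomials, one per cell, that agrees with it inside the cells;
    integrals and one-sided traces see nothing else. The other obstacle is time. The scaling
    function depends on the solution through the sup norm of E, whose continuity in time must be
    known before alpha can be differentiated, and alpha' is computed for t > 0 only. Norm and energy
    are therefore controlled by the sign of a derivative on positive times together with continuity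
    at 0. The estimate behind (2) is pointwise in x: once the integrands are collected, the only
    fact about E that is used is |E(x)| <= |E|_oo, and the defect in the inequality is at least a
    sum of squares (alpha / (2 gamma)) (C_n - gamma alpha E D_{n+1})^2. This bounds the square of
    the norm at rate 1/(2 gamma), whence 1/(4 gamma) for the norm. For (3), the Gauss equation can
    be differentiated in time without a source from rho0 only after conservation of mass has shown
    that rho0 is constant. *)

Section OneSidedTimeDerivative.
Context {R : realType}.
Implicit Types (f g : R -> R) (t d e : R).

Local Notation time_nbhs t := (within [set s : R | 0 <= s] t^').

(** Gives uniqueness of limits. Points slightly to the right of [t] stay in the half-line, so the
    filter is proper even at [t = 0]. *)
Lemma time_nbhs_proper t : 0 <= t -> ProperFilter (time_nbhs t).
Proof.
move=> t0; apply: Build_ProperFilter_ex => A.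
rewrite /within/= => /nbhs_ballP[e /= e0 eA].
exists (t + e / 2); apply: eA => /=.
- by rewrite /ball/= opprD addNKr normrN gtr0_norm ?divr_gt0// ltr_pdivrMr// ltr_pMr// ltr1n.
- by rewrite gt_eqF// ltrDl divr_gt0.
- by rewrite addr_ge0// ltW// divr_gt0.
Qed.

Lemma time_nearW t (P : set R) :
  (forall s, 0 <= s -> s != t -> P s) -> \forall s \near time_nbhs t, P s.
Proof.
by move=> H; apply: (@filterE _ (nbhs t)) => s st s0; exact: H.
Qed.

Lemma time_nbhs_id t : (fun s => s) @ time_nbhs t --> t.
Proof.
apply: cvg_trans (_ : nbhs t --> t); last exact: cvg_id.
by apply: cvg_trans (cvg_within _) _; exact: cvg_within.
Qed.

(** Relational form of the derivative: [ddt] is a [lim], meaningful only when the limit exists, so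
    the calculus rules are stated for convergence to a given value. *)
Definition is_ddt f t d := time_quotient f t @ time_nbhs t --> d.

Lemma is_ddtE f t d : 0 <= t -> is_ddt f t d -> ddt f t = d.
Proof. by move=> t0 fd; apply: cvg_lim => //; exact: time_nbhs_proper. Qed.

Lemma is_ddt_derivable f t d : is_ddt f t d -> time_derivable f t.
Proof. by move=> fd; apply/cvg_ex; exists d. Qed.

Lemma is_ddt_ddt f t : time_derivable f t -> is_ddt f t (ddt f t).
Proof. by []. Qed.

(** The filter sees only [s >= 0], the times at which the equations of the scheme are imposed. *)
Lemma eq_is_ddt f g t d : 0 <= t -> (forall s, 0 <= s -> f s = g s) ->
  is_ddt f t d -> is_ddt g t d.
Proof.
move=> t0 fg; apply: cvg_trans; apply: near_eq_cvg; apply: time_nearW => s s0 _.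
by rewrite /time_quotient !fg.
Qed.

Lemma is_ddt_cst (c : R) t : is_ddt (fun=> c) t 0.
Proof.
apply: (@cvg_trans _ ((fun=> 0 : R) @ time_nbhs t)); last exact: cvg_cst.
apply: near_eq_cvg; apply: time_nearW => s _ _.
by rewrite /time_quotient subrr mul0r.
Qed.

Lemma is_ddtD f g t d e : is_ddt f t d -> is_ddt g t e ->
  is_ddt (fun s => f s + g s) t (d + e).
Proof.
move=> fd ge; apply: cvg_trans (cvgD fd ge); apply: near_eq_cvg.
by apply: time_nearW => s _ _; rewrite /time_quotient/= opprD addrACA mulrDl.
Qed.

Lemma is_ddt_continuous f t d : is_ddt f t d -> f @ time_nbhs t --> f t.
Proof.
move=> fd; have : (fun s => f t + time_quotient f t s * (s - t)) @ time_nbhs t --> f t + d * (t - t).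
  apply: cvgD; first exact: cvg_cst.
  apply: cvgM => //; apply: cvgB; [exact: time_nbhs_id | exact: cvg_cst].
rewrite subrr mulr0 addr0; apply: cvg_trans; apply: near_eq_cvg.
apply: time_nearW => s _ st; rewrite /time_quotient divfK ?subr_eq0//.
by rewrite addrC subrK.
Qed.

Lemma is_ddtM f g t d e : is_ddt f t d -> is_ddt g t e ->
  is_ddt (fun s => f s * g s) t (d * g t + f t * e).
Proof.
move=> fd ge; have gt := is_ddt_continuous _ _ _ ge.
apply: cvg_trans (cvgD (cvgM fd gt) (cvgM (cvg_cst (f t)) ge)).
apply: near_eq_cvg; apply: time_nearW => s _ _.
rewrite /time_quotient addrfctE /=; ring.
Qed.

Lemma is_ddtMl (c : R) f t d : is_ddt f t d -> is_ddt (fun s => c * f s) t (c * d).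
Proof. by move=> /(is_ddtM _ _ _ _ _ (is_ddt_cst c t)); rewrite mul0r add0r. Qed.

Lemma is_ddtMr (c : R) f t d : is_ddt f t d -> is_ddt (fun s => f s * c) t (d * c).
Proof.
by move=> /is_ddtM /(_ (is_ddt_cst c t)); rewrite mulr0 addr0.
Qed.

Lemma is_ddt_sum (I : Type) (r : seq I) (P : pred I) (f : I -> R -> R) t (d : I -> R) :
  (forall i, P i -> is_ddt (f i) t (d i)) ->
  is_ddt (fun s => \sum_(i <- r | P i) f i s) t (\sum_(i <- r | P i) d i).
Proof.
move=> fd; elim: r => [|i r IH].
  under [X in is_ddt X]eq_fun do rewrite big_nil.
  by rewrite big_nil; exact: is_ddt_cst.
rewrite big_cons; under [X in is_ddt X]eq_fun do rewrite big_cons.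
case: (boolP (P i)) => // Pi.
exact: is_ddtD (fd _ Pi) IH.
Qed.

Lemma is_derive_is_ddt f t d : is_derive t 1 f d -> is_ddt f t d.
Proof.
case=> df <-; have := df; rewrite /derivable => /cvg_ex[l fl].
have -> : 'D_1 f t = l by apply: cvg_lim => //.
rewrite /is_ddt; apply: (@cvg_trans _ (time_quotient f t @ t^')).
  by apply: cvg_app; exact: cvg_within.
have : (fun s => s - t) @ t^' --> 0^'.
  move=> A /= [e /= e0 eA]; exists e => //= s; rewrite /ball/= => ts st.
  apply: eA; rewrite /ball/= ?sub0r ?opprB// ?distrC// subr_eq0//.
move/(cvg_comp _ _) => /(_ _ _ _ fl); apply: cvg_trans; apply: near_eq_cvg.
near=> s; rewrite /time_quotient/= /GRing.scale/= mulr1 subrK.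
by rewrite [RHS]mulrC.
Unshelve. all: by end_near. Qed.

(** For [t > 0] the constraint [s >= 0] is eventually void, which gives access to the results on
    two-sided derivatives. *)
Lemma is_ddt_is_derive f t d : 0 < t -> is_ddt f t d -> is_derive t 1 f d.
Proof.
move=> t0 fd.
have fd' : time_quotient f t @ t^' --> d.
  apply: cvg_trans fd; apply: cvg_app => A; rewrite /within/= => H.
  near=> s; have s0 : 0 <= s by near: s; apply: cvg_within; near do apply: ltW; exact: lt_nbhsr.
  by move: s0; near: s; exact: H.
suff H : (fun h => h^-1 *: (f (h *: 1 + t) - f t)) @ 0^' --> d.
  by split; [apply/cvg_ex; exists d | exact: cvg_lim].
have : (fun h => h + t) @ (0:R)^' --> t^'.
  move=> A /= [e /= e0 eA]; exists e => //= s; rewrite /ball/= sub0r normrN => ts st.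
  apply: eA; last by rewrite -subr_eq0 addrK.
  by rewrite /ball/= [s + t]addrC opprD addNKr normrN.
move/(cvg_comp _ _) => /(_ _ _ _ fd'); apply: cvg_trans; apply: near_eq_cvg.
near=> s; rewrite /time_quotient/= /GRing.scale/= mulr1 addrK.
by rewrite [RHS]mulrC.
Unshelve. all: by end_near. Qed.

End OneSidedTimeDerivative.

(** * Monotonicity and Gronwall's inequality *)

Section TimeMonotonicity.
Context {R : realType}.
Implicit Types (f d : R -> R) (t c : R).

Local Notation time_nbhs t := (within [set s : R | 0 <= s] t^').

(** The mean value theorem on [[0, t]] asks for a derivative in the open interval and continuity at
    its ends. This fits [alpha], whose derivative is computed at positive times only. *)
Lemma is_ddt_nonincreasing f d :
  f @ time_nbhs 0 --> f 0 ->
  (forall t, 0 < t -> is_ddt f t (d t)) -> (forall t, 0 < t -> d t <= 0) ->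
  forall t, 0 <= t -> f t <= f 0.
Proof.
move=> f0 fd d0 t; rewrite le_eqVlt => /predU1P[<-//|t0].
have fD (s : R) : 0 < s -> is_derive s 1 f (d s).
  by move=> s0; apply: is_ddt_is_derive => //; exact: fd.
have cf (s : R) : 0 < s -> {for s, continuous f}.
  by move=> s0; apply: differentiable_continuous; apply/derivable1_diffP; case: (fD _ s0).
have cc : {within `[0, t], continuous f}.
  apply/continuous_within_itvP => //; split.
  - by move=> s /[!in_itv]/= /andP[s0 _]; exact: cf.
  - apply: cvg_trans f0; apply: cvg_app => A; rewrite /within/= /dnbhs /within/= => H.
    by move: H; apply: (@filterS _ (nbhs (0:R))) => s H s0; apply: H; rewrite ?gt_eqF// ltW.
  - by apply: cvg_at_left_filter; exact: cf.
apply: (@ler0_derive1_le_cc _ f 0 t _ _ cc) => //; rewrite ?in_itv/= ?lexx ?ltW//.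
- by move=> s /[!in_itv]/= /andP[s0 _]; case: (fD _ s0).
- by move=> s /[!in_itv]/= /andP[s0 _]; rewrite derive1E; case: (fD _ s0) => _ ->; exact: d0.
Qed.

Lemma is_ddt_constant f :
  f @ time_nbhs 0 --> f 0 -> (forall t, 0 < t -> is_ddt f t 0) ->
  forall t, 0 <= t -> f t = f 0.
Proof.
move=> f0 fd t t0; apply/eqP; rewrite eq_le; apply/andP; split.
  by apply: (is_ddt_nonincreasing f (fun=> 0)) t t0.
rewrite -lerN2; apply: (is_ddt_nonincreasing (fun s => - f s) (fun=> 0)) t t0 => //.
  exact: cvgN.
move=> s s0; have := is_ddtMl (-1) _ _ _ (fd s s0); rewrite mulr0.
by apply: eq_is_ddt => [|r _]; [exact: ltW | rewrite mulN1r].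
Qed.

Lemma is_ddt_expR c t : is_ddt (fun s => expR (c * s)) t (c * expR (c * t)).
Proof.
apply: is_derive_is_ddt.
apply: (@is_derive_eq _ _ _ _ _ _ _ _ (is_derive1_comp _ _)) => //.
by rewrite /GRing.scale/= mulr1 mulrC.
Qed.

(** The integrating factor [expR (- c * t)] reduces the inequality to the monotonicity of a
    product. *)
Lemma gronwall f d c :
  f @ time_nbhs 0 --> f 0 ->
  (forall t, 0 < t -> is_ddt f t (d t)) -> (forall t, 0 < t -> d t <= c * f t) ->
  forall t, 0 <= t -> f t <= f 0 * expR (c * t).
Proof.
move=> f0 fd dc t t0.
have : f t * expR (- c * t) <= f 0 * expR (- c * 0).
  apply: (is_ddt_nonincreasing (fun s => f s * expR (- c * s))
     (fun s => d s * expR (- c * s) + f s * (- c * expR (- c * s)))) t t0.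
  - by apply: cvgM => //; apply: is_ddt_continuous; exact: is_ddt_expR.
  - by move=> s s0; apply: is_ddtM; [exact: fd | exact: is_ddt_expR].
  - move=> s s0; rewrite mulrA -mulrDl mulrN mulNr pmulr_lle0 ?expR_gt0//.
    by rewrite subr_le0 mulrC dc.
by rewrite mulr0 expR0 mulr1 mulNr expRN ler_pdivrMr ?expR_gt0.
Qed.

End TimeMonotonicity.

(** * Polynomials on the cells of a mesh *)

Section PolynomialIntegral.
Context {R : realType}.
Local Notation mu := (@lebesgue_measure R).
Implicit Types (a b : R) (p q : {poly R}).

Definition poly_int a b p : R := \int[mu]_(x in `[a, b]) p.[x].

Lemma integrable_horner a b p : mu.-integrable `[a, b] (EFin \o horner p).
Proof.
apply: continuous_compact_integrable; first exact: segment_compact.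
by apply: continuous_subspaceT => x; exact: continuous_horner.
Qed.

Lemma integral_hornerE a b p :
  (\int[mu]_(x in `[a, b]) (p.[x])%:E)%E = (poly_int a b p)%:E.
Proof.
by rewrite /poly_int /Rintegral fineK//; apply: integrable_fin_num; [|exact: integrable_horner].
Qed.

Lemma poly_int_is_linear a b : scalar (poly_int a b).
Proof.
move=> c p q; rewrite /poly_int -RintegralZl//; last exact: integrable_horner.
rewrite -RintegralD//; first by apply: eq_Rintegral => x _; rewrite !hornerE.
- have -> : (EFin \o (fun x => c * p.[x])) = EFin \o horner (c *: p).
    by apply/funext => x /=; rewrite hornerZ.
  exact: integrable_horner.
- exact: integrable_horner.
Qed.

HB.instance Definition _ a b :=
  GRing.isLinear.Build R {poly R} R *%R (poly_int a b) (poly_int_is_linear a b).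

Lemma poly_int_deriv a b p : a < b -> poly_int a b p^`() = p.[b] - p.[a].
Proof.
move=> ab; apply: EFin_inj; rewrite -integral_hornerE EFinB.
apply: continuous_FTC2 => //.
- by apply: continuous_subspaceT => x; exact: continuous_horner.
- split.
  + by move=> x _; exact: derivable_horner.
  + by apply: cvg_at_right_filter; exact: continuous_horner.
  + by apply: cvg_at_left_filter; exact: continuous_horner.
- by move=> x _; rewrite derivE.
Qed.

(** [f] is arbitrary at [a] and [b], since elements of V_h have no prescribed nodal values; adding
    two points to the open interval preserves measurability. *)
Lemma measurable_cell_fun a b (f : R -> R) p :
  {in `]a, b[, forall x, f x = p.[x]} -> measurable_fun `[a, b] f.
Proof.
move=> fp; apply/measurable_fun_itv_bndo_bndcP/measurable_fun_itv_obnd_cbndP.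
apply: (@eq_measurable_fun _ _ _ _ _ (horner p)).
  by move=> x /[!inE] xab; rewrite fp.
apply: measurable_funTS; apply: continuous_measurable_fun.
by move=> x; exact: continuous_horner.
Qed.

Lemma integral_cell a b (f : R -> R) p :
  {in `]a, b[, forall x, f x = p.[x]} ->
  (\int[mu]_(x in `[a, b]) (f x)%:E)%E = (poly_int a b p)%:E.
Proof.
move=> fp; rewrite -integral_hornerE; apply: eq_integral_itv_bounded => //.
  by apply: (measurable_funS _ _ (measurable_cell_fun _ _ _ _ fp)) => //; exact: subset_itv_oo_cc.
apply: measurable_funTS; apply: continuous_measurable_fun.
by move=> x; exact: continuous_horner.
Qed.

Lemma Rintegral_cell a b (f : R -> R) p :
  {in `]a, b[, forall x, f x = p.[x]} ->
  \int[mu]_(x in `[a, b]) f x = poly_int a b p.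
Proof. by move=> fp; rewrite /Rintegral (integral_cell _ _ _ _ fp). Qed.

Lemma poly_int_ge0 a b p : {in `]a, b[, forall x, 0 <= p.[x]} -> 0 <= poly_int a b p.
Proof.
move=> p0; rewrite -(Rintegral_cell a b (fun x => `|p.[x]|)).
  exact: Rintegral_ge0.
by move=> x xab; rewrite ger0_norm ?p0.
Qed.

Lemma cell_trace_right a b (u : R -> R) p : a < b ->
  {in `]a, b[, forall x, u x = p.[x]} -> lim (u @ a^'+) = p.[a].
Proof.
move=> ab up; apply: cvg_lim => //.
have pl : horner p @ a^'+ --> p.[a].
  by apply: cvg_at_right_filter; exact: continuous_horner.
apply: cvg_trans pl.
apply: near_eq_cvg; near=> x; rewrite up// in_itv/=; apply/andP; split; near: x.
- exact: nbhs_right_gt.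
- exact: nbhs_right_lt.
Unshelve. all: by end_near. Qed.

Lemma cell_trace_left a b (u : R -> R) p : a < b ->
  {in `]a, b[, forall x, u x = p.[x]} -> lim (u @ b^'-) = p.[b].
Proof.
move=> ab up; apply: cvg_lim => //.
have pl : horner p @ b^'- --> p.[b].
  by apply: cvg_at_left_filter; exact: continuous_horner.
apply: cvg_trans pl.
apply: near_eq_cvg; near=> x; rewrite up// in_itv/=; apply/andP; split; near: x.
- exact: nbhs_left_gt.
- exact: nbhs_left_lt.
Unshelve. all: by end_near. Qed.

End PolynomialIntegral.

(** * Integration over the whole mesh *)

Section MeshIntegral.
Context {R : realType}.
Local Notation mu := (@lebesgue_measure R).
Variables (L : R) (Nx : nat) (xh : nat -> R).
Hypothesis mesh : is_mesh L Nx xh.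

Lemma mesh_lt j : (j < Nx)%N -> xh j < xh j.+1.
Proof. by case: mesh => _ _; exact. Qed.

Lemma mesh_bounds j : (j <= Nx)%N -> 0 <= xh j <= L.
Proof.
case: mesh => x0 xL xlt jN; apply/andP; split.
- elim: j jN => [|j IH] jN; first by rewrite x0.
  by rewrite (le_trans (IH (ltnW jN)))// ltW// xlt.
- rewrite -xL; have [d] : exists d, (j + d = Nx)%N by exists (Nx - j)%N; rewrite subnKC.
  elim: d j {jN} => [|d IH] j; first by rewrite addn0 => ->.
  move=> jd; apply: (le_trans _ (IH j.+1 _)); last by rewrite addSnnS.
  by rewrite ltW// xlt// -jd addnS ltnS leq_addr.
Qed.

(** Induction on the number of cells. Measurability on the union so far is carried along because
    additivity of the integral requires it; each new cell is added without its left node to keep the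
    pieces disjoint. *)
Lemma integral_mesh (f : R -> R) (p : nat -> {poly R}) :
  (forall j, (j < Nx)%N -> {in `]xh j, xh j.+1[, forall x, f x = (p j).[x]}) ->
  (\int[mu]_(x in `[0%R, L]) (f x)%:E)%E
  = (\sum_(j < Nx) poly_int (xh j) (xh j.+1) (p j))%:E.
Proof.
move=> fp; have [x0 xL _] := mesh.
have H m : (m <= Nx)%N -> measurable_fun `[xh 0, xh m] f /\
    (\int[mu]_(x in `[xh 0, xh m]) (f x)%:E)%E
    = (\sum_(j < m) poly_int (xh j) (xh j.+1) (p j))%:E.
elim: m => [_|m IH mN].
  rewrite set_itv1 big_ord0; split; first exact: measurable_fun_set1.
  by rewrite integral_set1.
have [mf If] := IH (ltnW mN).
have mle : xh 0 <= xh m by rewrite x0; case/andP: (mesh_bounds _ (ltnW mN)).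
have mlt : xh m < xh m.+1 by exact: mesh_lt.
have mfm := measurable_cell_fun _ _ _ _ (fp m mN).
have mfo : measurable_fun `]xh m, xh m.+1] f.
  by apply: (measurable_funS _ _ mfm) => //; apply: subset_itvr; rewrite bnd_simp.
have E : (`[xh 0, xh m.+1] = `[xh 0, xh m] `|` `]xh m, xh m.+1])%classic.
  by apply: itv_bndbnd_setU; rewrite bnd_simp// ltW.
have mfU : measurable_fun `[xh 0, xh m.+1] f.
  by rewrite E; apply/measurable_funU.
split=> //; rewrite E integral_setU//.
- rewrite If big_ord_recr/= EFinD; congr (_ + _)%E.
  rewrite integral_itv_obnd_cbnd; last exact/measurable_EFinP.
  exact: integral_cell (fp m mN).
- by rewrite -E; exact/measurable_EFinP.
- apply/disj_setPS => x [] /=; rewrite !in_itv/= => /andP[_ xm] /andP[mx _].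
  by move: (lt_le_trans mx xm); rewrite ltxx.
by have [_] := H _ (leqnn Nx); rewrite x0 xL.
Qed.

Lemma Rintegral_mesh (f : R -> R) (p : nat -> {poly R}) :
  (forall j, (j < Nx)%N -> {in `]xh j, xh j.+1[, forall x, f x = (p j).[x]}) ->
  \int[mu]_(x in `[0, L]) f x = \sum_(j < Nx) poly_int (xh j) (xh j.+1) (p j).
Proof. by move=> fp; rewrite /Rintegral (integral_mesh _ _ fp). Qed.

End MeshIntegral.

(** * Lagrange interpolation inside a cell *)

Section Interpolation.
Context {R : realType}.
Variables (xh : nat -> R) (k : nat).

(** Equally spaced points; the shift [i.+1] and the divisor [k.+2] keep all [k.+1] of them strictly
    inside the cell, where [Vh] constrains the values. *)
Definition sample (j i : nat) : R :=
  xh j + (xh j.+1 - xh j) * (i.+1%:R / k.+2%:R).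

Definition cellpoly (j : nat) (u : R -> R) : {poly R} :=
  \sum_(i < k.+1) u (sample j i) *: ((lagrange k.+1 (sample j))`_i : {poly R}).

Lemma sample_cell j i : xh j < xh j.+1 -> (i < k.+1)%N ->
  sample j i \in `]xh j, xh j.+1[.
Proof.
move=> jlt ik; rewrite in_itv/= /sample ltrDl; apply/andP; split.
  by rewrite mulr_gt0 ?subr_gt0// divr_gt0.
by rewrite -ltrBrDl gtr_pMr ?subr_gt0// ltr_pdivrMr ?mul1r ?ltr_nat.
Qed.

Lemma sample_inj j : xh j < xh j.+1 -> injective (sample j).
Proof.
move=> jlt i1 i2 /addrI /mulfI; rewrite subr_eq0 gt_eqF// => /(_ isT).
by move/divIf; rewrite pnatr_eq0 => /(_ isT) /eqP; rewrite eqr_nat => /eqP[].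
Qed.

Lemma size_cellpoly j u : (size (cellpoly j u) <= k.+1)%N.
Proof.
apply: (leq_trans (size_sum _ _ _)); apply/bigmax_leqP => i _.
by apply: leq_trans (size_scale_leq _ _) _; rewrite size_npoly.
Qed.

(** A polynomial of degree at most [k] is determined by its values at [k.+1] distinct points. *)
Lemma cellpolyE j u (p : {poly R}) : xh j < xh j.+1 -> (size p <= k.+1)%N ->
  {in `]xh j, xh j.+1[, forall x, u x = p.[x]} -> cellpoly j u = p.
Proof.
move=> jlt sp up; rewrite [RHS](lagrange_gen (ltn0Sn k) (sample_inj _ jlt) sp).
apply: eq_bigr => i _; rewrite up ?sample_cell// mul_polyC; congr (_ *: _).
by rewrite (nth_lagrange _ _).
Qed.

End Interpolation.

(** * Hermite functions *)

Section GaussianMoments.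
Context {R : realType}.
Local Notation mu := (@lebesgue_measure R).
Implicit Types (a v y e : R) (p q : {poly R}).

(** Induction on the degree: half of the exponent [e] goes to the lower-degree factor, the other
    half absorbs the extra factor [y]. *)
Lemma horner_le_expR p e : 0 < e ->
  exists2 K : R, 0 <= K & forall y, `|p.[y]| <= K * expR (e * y ^+ 2).
Proof.
elim/poly_ind: p e => [|p c IH] e e0.
  by exists 0 => // y; rewrite horner0 normr0 mul0r.
have d0 : 0 < e / 2 by rewrite divr_gt0.
have [K K0 Kp] := IH _ d0.
(* Chosen so that [C * (1 + e / 2 * y ^+ 2)] dominates [1 + y ^+ 2], hence [|y|]. *)
pose C := 1 + (e / 2)^-1.
have C0 : 0 <= C by rewrite addr_ge0// invr_ge0 ltW.
exists (K * C + `|c|) => [|y]; first by rewrite addr_ge0// mulr_ge0.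
have ey : `|y| <= C * expR (e / 2 * y ^+ 2).
  apply: (@le_trans _ _ (C * (1 + e / 2 * y ^+ 2))); last first.
    by rewrite ler_wpM2l// expR_ge1Dx.
  have -> : C * (1 + e / 2 * y ^+ 2)
      = 1 + y ^+ 2 + ((e / 2)^-1 + e / 2 * y ^+ 2).
    by rewrite /C; field; rewrite gt_eqF.
  rewrite -[y ^+ 2]real_normK ?num_real//.
  have : 0 <= (e / 2)^-1 + e / 2 * `|y| ^+ 2.
    by rewrite addr_ge0 ?invr_ge0 ?mulr_ge0// ltW.
  by have := normr_ge0 y; nra.
rewrite hornerMXaddC (le_trans (ler_normD _ _))// mulrDl lerD//.
  rewrite normrM (_ : e * y ^+ 2 = e / 2 * y ^+ 2 + e / 2 * y ^+ 2); last by field.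
  rewrite expRD [leRHS](_ : _ = (K * expR (e / 2 * y ^+ 2)) * (C * expR (e / 2 * y ^+ 2))); last by ring.
  exact: ler_pM.
by rewrite ler_peMr// -[leLHS]expR0 ler_expR mulr_ge0 ?sqr_ge0// ltW.
Qed.

(** The centred normal density of standard deviation [a^-1]. It is normalised so that
    [Psi m a v * Psi n a v * omega a v] equals [a] times the two Hermite factors times
    [gaussw a v]. *)
Definition gaussw a v : R := a / Num.sqrt (2 * pi) * expR (- ((a * v) ^+ 2 / 2)).

Lemma gaussw_normal_pdf a v : 0 < a -> gaussw a v = normal_pdf 0 a^-1 v.
Proof.
move=> a0; rewrite normal_pdfE ?invr_neq0 ?gt_eqF// /gaussw /normal_peak /normal_fun.
congr (_ * expR _); last first.
  by rewrite subr0; field; rewrite gt_eqF.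
rewrite (_ : a^-1 ^+ 2 * pi *+ 2 = a^-1 ^+ 2 * (2 * pi)); last by ring.
by rewrite [Num.sqrt (a^-1 ^+ 2 * _)]sqrtrM ?sqr_ge0// sqrtr_sqr ger0_norm ?invr_ge0 ?ltW// invfM invrK.
Qed.

Lemma continuous_gaussw a : continuous (gaussw a).
Proof.
move=> v; apply: cvgM; first exact: cvg_cst.
apply: (@continuous_comp _ _ _ (fun v => - ((a * v) ^+ 2 / 2)) expR); last exact: continuous_expR.
have -> : (fun v => - ((a * v) ^+ 2 / 2)) = horner (- (a ^+ 2 / 2) *: 'X^2).
  by apply/funext => w; rewrite hornerZ hornerXn; ring.
exact: continuous_horner.
Qed.

Lemma horner_scaleE p a : (fun v => p.[a * v]) = horner (p \Po (a *: 'X)).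
Proof. by apply/funext => v; rewrite horner_comp hornerZ hornerX. Qed.

Lemma measurable_horner_gaussw a p (D : set R) :
  measurable_fun D (fun v => p.[a * v] * gaussw a v).
Proof.
apply: measurable_funTS; apply: continuous_measurable_fun => v.
apply: cvgM; last exact: continuous_gaussw.
have : continuous (fun v => p.[a * v]) by rewrite horner_scaleE; exact: continuous_horner.
exact.
Qed.

(** With [e = 4^-1] the polynomial uses half of the Gaussian exponent. What is left is the Gaussian
    of parameter [a / sqrt 2], and [sqrt 2] in the constant corrects its normalisation. *)
Lemma horner_gaussw_le a p : 0 < a -> exists2 K : R, 0 <= K &
  forall v, `|p.[a * v] * gaussw a v| <= K * gaussw (a / Num.sqrt 2) v.
Proof.
move=> a0; have [|K K0 Kp] := horner_le_expR p 4^-1; first by [].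
have s20 : 0 < Num.sqrt 2 :> R by rewrite sqrtr_gt0.
exists (K * Num.sqrt 2) => [|v]; first by rewrite mulr_ge0.
rewrite normrM [`|gaussw a v|]ger0_norm; last first.
  by rewrite mulr_ge0 ?expR_ge0// divr_ge0 ?sqrtr_ge0// ltW.
apply: (@le_trans _ _ (K * expR (4^-1 * (a * v) ^+ 2) * gaussw a v)).
  by rewrite ler_wpM2r// mulr_ge0 ?expR_ge0// divr_ge0 ?sqrtr_ge0// ltW.
rewrite /gaussw le_eqVlt; apply/orP; left; apply/eqP.
rewrite (_ : (a / Num.sqrt 2 * v) ^+ 2 = (a * v) ^+ 2 / 2); last first.
  by rewrite -mulrA mulrCA -mulrCA !exprMn exprVn sqr_sqrtr//; ring.
transitivity (K * (a / Num.sqrt (2 * pi)) * (expR (4^-1 * (a * v) ^+ 2) * expR (- ((a * v) ^+ 2 / 2)))).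
  by ring.
rewrite -expRD (_ : 4^-1 * _ + _ = - ((a * v) ^+ 2 / 2 / 2)); last by field.
by field; apply/andP; split; rewrite gt_eqF// sqrtr_gt0 mulr_gt0// pi_gt0.
Qed.

Lemma integrable_gaussw a : 0 < a -> mu.-integrable setT (EFin \o gaussw a).
Proof.
move=> a0; rewrite (_ : _ \o _ = fun v => (normal_pdf 0 a^-1 v)%:E).
  exact: integrable_normal_pdf.
by apply/funext => v /=; rewrite gaussw_normal_pdf.
Qed.

Lemma integrable_horner_gaussw a p : 0 < a ->
  mu.-integrable setT (EFin \o (fun v => p.[a * v] * gaussw a v)).
Proof.
move=> a0; have [K K0 Kp] := horner_gaussw_le a p a0.
have b0 : 0 < a / Num.sqrt 2 by rewrite divr_gt0// sqrtr_gt0.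
apply: (@le_integrable _ _ _ mu _ measurableT _ (fun v => (K%:E * (gaussw (a / Num.sqrt 2) v)%:E)%E)).
- by apply/measurable_EFinP; exact: measurable_horner_gaussw.
- by move=> v _; rewrite /= lee_fin (le_trans (Kp v))// ler_norm.
- exact: integrableZl (integrable_gaussw _ b0).
Qed.

(** For [a > 0], the expectation of [p] under the standard normal law, written in the variable
    [v]. *)
Definition gaussm a p : R := \int[mu]_v (p.[a * v] * gaussw a v).

Lemma integral_horner_gaussw a p : 0 < a ->
  (\int[mu]_v (p.[a * v] * gaussw a v)%:E)%E = (gaussm a p)%:E.
Proof.
move=> a0; rewrite /gaussm /Rintegral fineK//.
by apply: integrable_fin_num; [|exact: integrable_horner_gaussw].
Qed.

Lemma gaussm1 a : 0 < a -> gaussm a 1 = 1.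
Proof.
move=> a0; apply: EFin_inj; rewrite -integral_horner_gaussw//.
under eq_integral do rewrite hornerC mul1r gaussw_normal_pdf//.
exact: integral_normal_pdf.
Qed.

Lemma gaussm_linear a c p q : 0 < a ->
  gaussm a (c *: p + q) = c * gaussm a p + gaussm a q.
Proof.
move=> a0; rewrite /gaussm -RintegralZl//; last exact: integrable_horner_gaussw.
rewrite -RintegralD//; [|idtac|exact: integrable_horner_gaussw].
  by apply: eq_Rintegral => v _; rewrite hornerD hornerZ; ring.
rewrite (_ : _ \o _ = EFin \o (fun v => (c *: p).[a * v] * gaussw a v)).
  exact: integrable_horner_gaussw.
by apply/funext => v /=; rewrite hornerZ mulrA.
Qed.

Lemma gaussm0 a : 0 < a -> gaussm a 0 = 0.
Proof.
move=> a0; have := gaussm_linear a (-1) 0 0 a0.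
by rewrite scaler0 addr0 mulN1r addNr.
Qed.

Lemma gaussmZ a c p : 0 < a -> gaussm a (c *: p) = c * gaussm a p.
Proof. by move=> a0; rewrite -[c *: p]addr0 gaussm_linear// gaussm0// addr0. Qed.

Lemma gaussmD a p q : 0 < a -> gaussm a (p + q) = gaussm a p + gaussm a q.
Proof. by move=> a0; rewrite -{1}[p]scale1r gaussm_linear// mul1r. Qed.

Lemma is_derive_horner_gaussw a p v :
  is_derive v 1 (fun v => p.[a * v] * gaussw a v)
    (a * ((p^`() - 'X * p).[a * v] * gaussw a v)).
Proof.
have dp : is_derive v (1 : R) (fun v => p.[a * v]) (p^`().[a * v] * a).
  rewrite horner_scaleE; apply: is_derive_eq.
  by rewrite deriv_comp hornerM horner_comp derivZ derivX !hornerE/= mulr1.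
have dg : is_derive v (1 : R) (gaussw a) (- (a ^+ 2 * v) * gaussw a v).
  have dq : is_derive v (1 : R) (fun v => - ((a * v) ^+ 2 / 2)) (- (a ^+ 2 * v)).
    have -> : (fun v => - ((a * v) ^+ 2 / 2)) = horner (- (a ^+ 2 / 2) *: 'X^2).
      by apply/funext => w; rewrite hornerZ hornerXn; ring.
    by apply: is_derive_eq; rewrite derivZ derivXn !hornerE; field.
  have de := is_derive1_comp (is_derive_expR _) dq.
  have := is_deriveZ (a / Num.sqrt (2 * pi)) de.
  rewrite /gaussw => H; apply: is_derive_eq.
  by rewrite /GRing.scale/=; ring.
have H := is_deriveM dp dg; apply: is_derive_eq.
rewrite /GRing.scale/= hornerD hornerN hornerM hornerX. by ring.
Qed.

End GaussianMoments.

(** * Orthonormality of the Hermite polynomials *)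

Section HermiteOrthonormality.
Context {R : realType}.
Local Notation mu := (@lebesgue_measure R).
Implicit Types (a v y e : R) (p q : {poly R}).

(** Since [n <= n ^ 2], the sequence is bounded by a geometric one. It controls the boundary terms
    in the integration by parts on the real line. *)
Lemma cvg_gaussw_nat a : 0 < a -> (fun n : nat => gaussw a n%:R) @ \oo --> 0.
Proof.
move=> a0; pose z := expR (- (a ^+ 2 / 2)).
have z1 : `|z| < 1.
  by rewrite ger0_norm ?expR_ge0// expR_lt1 oppr_lt0 divr_gt0 ?exprn_gt0.
have c0 : 0 <= a / Num.sqrt (2 * pi) by rewrite divr_ge0 ?sqrtr_ge0 ?ltW.
apply: (@squeeze_cvgr _ _ _ _ (fun=> 0) (fun n => a / Num.sqrt (2 * pi) * z ^+ n)).
- apply: nearW => n; rewrite mulr_ge0 ?expR_ge0//= /gaussw ler_wpM2l//.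
  rewrite /z -expRM_natl ler_expR mulrN lerN2.
  rewrite (_ : (a * n%:R) ^+ 2 / 2 = n%:R ^+ 2 * (a ^+ 2 / 2)); last by ring.
  rewrite ler_wpM2r// ?divr_ge0 ?sqr_ge0// -natrX ler_nat.
  by case: n => // n; rewrite expnS leq_pmulr// expn_gt0.
- exact: cvg_cst.
- by rewrite -[X in _ --> X](mulr0 (a / Num.sqrt (2 * pi))); apply: cvgM; [exact: cvg_cst | exact: cvg_expr].
Qed.

Lemma gaussw_even a v : gaussw a (- v) = gaussw a v.
Proof. by rewrite /gaussw mulrN sqrrN. Qed.

(** Dominated convergence, with [|f|] as dominating function; it reduces integrals over the line to
    segments, where the fundamental theorem of calculus applies. *)
Lemma Rintegral_nat_cvg (f : R -> R) : mu.-integrable setT (EFin \o f) ->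
  (fun n : nat => \int[mu]_(v in `[- n%:R, n%:R]) f v) @ \oo --> \int[mu]_v f v.
Proof.
move=> fi; have mf := measurable_int _ fi.
have [] := @dominated_convergence _ _ R mu setT measurableT
  (fun n => (EFin \o f) \_ `[- n%:R, n%:R]) (EFin \o f) (fun v => `|f v|%:E).
- move=> n; apply/(measurable_restrictT _ _).1 => //.
  exact: measurable_funTS.
- by [].
- apply: aeW => v _ /=.
  apply: (@cvg_trans _ ((fun=> (f v)%:E) @ \oo)); last exact: cvg_cst.
  apply: near_eq_cvg; near=> n; rewrite patchE mem_set//= in_itv/= -ler_norml.
  by near: n; exact: nbhs_infty_ger.
- by have := integrable_abse fi.
- apply: aeW => v n _; rewrite patchE; case: ifP => _ //=.
  by rewrite lee_fin normr0.
move=> _ _ H.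
have : (fun n : nat => fine (\int[mu]_(x in setT) ((EFin \o f) \_ `[(- n%:R)%R, n%:R%R]) x)%E) @ \oo
   --> fine (\int[mu]_v (f v)%:E)%E.
  apply: fine_cvg; rewrite fineK//; exact: integrable_fin_num.
apply: cvg_trans; apply: near_eq_cvg; apply: nearW => n.
by rewrite /Rintegral -integral_mkcond.
Unshelve. all: by end_near. Qed.

Lemma gaussm_deriv a p : 0 < a -> gaussm a p^`() = gaussm a ('X * p).
Proof.
move=> a0; apply/eqP; rewrite -subr_eq0.
have <- : gaussm a (p^`() - 'X * p) = gaussm a p^`() - gaussm a ('X * p).
  by rewrite addrC -scaleN1r gaussm_linear// mulN1r addrC.
have b0 : 0 < a / Num.sqrt 2 by rewrite divr_gt0// sqrtr_gt0.
have [K K0 Kp] := horner_gaussw_le a p a0.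
pose F v := p.[a * v] * gaussw a v.
have H := Rintegral_nat_cvg _ (integrable_horner_gaussw a (p^`() - 'X * p) a0).
apply/eqP; apply: (cvg_unique _ H) => //.
(* The segment must be non-degenerate for the fundamental theorem, hence [n.+1]. *)
suff E n : \int[mu]_(v in `[- n.+1%:R, n.+1%:R])
    ((p^`() - 'X * p).[a * v] * gaussw a v) = a^-1 * (F n.+1%:R - F (- n.+1%:R)).
  apply/cvgrPdist_le => e e0.
  have g0 : (fun n : nat => a^-1 * (K * gaussw (a / Num.sqrt 2) n%:R *+ 2)) @ \oo --> 0.
    rewrite -[X in _ --> X](mulr0 a^-1); apply: cvgM; first exact: cvg_cst.
    rewrite -[X in _ --> X](mul0rn _ 2); apply: cvgMn.
    by rewrite -[X in _ --> X](mulr0 K); apply: cvgM; [exact: cvg_cst | exact: cvg_gaussw_nat].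
  move/cvgrPdist_le : g0 => /(_ _ e0) => g0.
  near=> n.
  have n0 : (0 < n)%N by near: n; exact: nbhs_infty_gt.
  have : `|0 - a^-1 * (K * gaussw (a / Num.sqrt 2) n%:R *+ 2)| <= e by near: n.
  rewrite !sub0r !normrN; apply: le_trans; rewrite -(prednK n0) E.
  rewrite !normrM ler_wpM2l// mulr2n (le_trans (ler_normB _ _))//.
  apply: le_trans (ler_norm _); rewrite lerD//; first exact: Kp.
  by rewrite -gaussw_even; exact: Kp.
have n0 : (- n.+1%:R : R) < n.+1%:R by rewrite gtrN.
apply: (@mulfI _ a); first by rewrite gt_eqF.
rewrite mulVKf ?gt_eqF// -RintegralZl//; last first.
  exact: integrableS (integrable_horner_gaussw a (p^`() - 'X * p) a0).
apply: EFin_inj; rewrite /Rintegral fineK; last first.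
  apply: integrable_fin_num => //.
  rewrite (_ : (fun _ => _) = EFin \o (fun v => (a *: (p^`() - 'X * p)).[a * v] * gaussw a v)).
    exact: integrableS (integrable_horner_gaussw a (a *: (p^`() - 'X * p)) a0).
  by apply/funext => v; rewrite /= hornerZ mulrA.
rewrite (@continuous_FTC2 _ _ F)//.
- apply: continuous_subspaceT => v; apply: cvgM; first exact: cvg_cst.
  apply: cvgM; last exact: continuous_gaussw.
  have : continuous (fun v => (p^`() - 'X * p).[a * v]) by rewrite horner_scaleE; exact: continuous_horner.
  exact.
- have cF : continuous F.
    move=> v; apply: differentiable_continuous; apply/derivable1_diffP.
    by case: (is_derive_horner_gaussw a p v).
  split.
  + by move=> v _; case: (is_derive_horner_gaussw a p v).
  + by apply: cvg_at_right_filter; exact: cF.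
  + by apply: cvg_at_left_filter; exact: cF.
- by move=> v _; rewrite derive1E; case: (is_derive_horner_gaussw a p v).
Unshelve. all: by end_near. Qed.

(** The recursion of [hermite], carried out in [{poly R}] where derivatives and products are
    formal. *)
Fixpoint hermite_poly (n : nat) : {poly R} :=
  if n is m.+1 then
    (Num.sqrt m.+1%:R)^-1 *:
      ('X * hermite_poly m - Num.sqrt m%:R *: (if m is l.+1 then hermite_poly l else 0))
  else 1.

Lemma hermite_polyS n : Num.sqrt n.+1%:R *: hermite_poly n.+1 =
  'X * hermite_poly n - Num.sqrt n%:R *: hermite_poly n.-1.
Proof.
rewrite [hermite_poly n.+1]/= scalerA mulfV ?scale1r ?gt_eqF ?sqrtr_gt0//.
by case: n => //=; rewrite sqrtr0 !scale0r.
Qed.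

Lemma horner_hermite_poly n y : (hermite_poly n).[y] = hermite n y.
Proof.
suff [] : (hermite_poly n).[y] = hermite n y /\ (hermite_poly n.+1).[y] = hermite n.+1 y by [].
elim: n => [|n [IH1 IH2]].
  by split; rewrite /= ?hornerC// hornerZ hornerD hornerN hornerM hornerX hornerZ !hornerC mulrC.
split=> //; change (hermite n.+2 y) with ((y * hermite n.+1 y - Num.sqrt n.+1%:R * hermite n y) / Num.sqrt n.+2%:R).
rewrite -IH1 -IH2; apply: (@mulfI _ (Num.sqrt n.+2%:R)); first by rewrite gt_eqF ?sqrtr_gt0.
rewrite -hornerZ hermite_polyS [n.+1.-1]/=; move: (hermite_poly n.+1) (hermite_poly n) => g h.
rewrite hornerD hornerN hornerM hornerX hornerZ.
by rewrite [RHS]mulrC divfK; last by rewrite gt_eqF ?sqrtr_gt0.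
Qed.

(** The lowering relation. The recursion has depth two, so the induction carries two consecutive
    indices. *)
Lemma deriv_hermite_poly n : (hermite_poly n)^`() = Num.sqrt n%:R *: hermite_poly n.-1.
Proof.
have s0 m : Num.sqrt m.+1%:R != 0 :> R by rewrite gt_eqF ?sqrtr_gt0.
suff [] : (hermite_poly n)^`() = Num.sqrt n%:R *: hermite_poly n.-1 /\
   (hermite_poly n.+1)^`() = Num.sqrt n.+1%:R *: hermite_poly n by [].
elim: n => [|n [IH1 IH2]].
  split; first by rewrite /= derivC sqrtr0 scale0r.
  rewrite /= sqrtr0 !scale0r subr0 mulr1 sqrtr1 invr1 !scale1r.
  exact: derivX.
split=> //; apply: (@scalerI _ _ (Num.sqrt n.+2%:R)) => //.
rewrite -derivZ hermite_polyS derivB derivZ derivM derivX mul1r IH2 IH1.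
rewrite -scalerAr -addrA -scalerBr -hermite_polyS /= -/(hermite_poly n.+1).
move: (hermite_poly n.+1) => h; rewrite !scalerA -!expr2 !sqr_sqrtr//.
by rewrite -[X in X + _]scale1r -scalerDl.
Qed.

(** ['X * H_m - H_m'] is [sqrt (m + 1) H_{m+1}], and integration by parts moves this raising
    operator onto [H_n] as a derivative. Both indices thus drop by one. *)
Lemma gaussm_hermite a m n : 0 < a ->
  gaussm a (hermite_poly m * hermite_poly n) = (m == n)%:R.
Proof.
move=> a0; have s0 l : Num.sqrt l.+1%:R != 0 :> R by rewrite gt_eqF ?sqrtr_gt0.
have gZ c p : gaussm a (c *: p) = c * gaussm a p by exact: gaussmZ.
have gD p q : gaussm a (p + q) = gaussm a p + gaussm a q by exact: gaussmD.
elim: m n => [|m IH] n.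
  rewrite mul1r; case: n => [|n]; first by rewrite gaussm1.
  suff : gaussm a (hermite_poly n.+1) = 0 by [].
  apply: (mulfI (s0 n)); rewrite mulr0 -gZ hermite_polyS gD -gaussm_deriv//.
  by rewrite deriv_hermite_poly -scaleNr !gZ mulNr subrr.
apply: (mulfI (s0 m)); rewrite -gZ scalerAl hermite_polyS mulrBl gD -mulrA.
rewrite -gaussm_deriv// derivM !deriv_hermite_poly gD -!scalerAl -scalerAr -scaleNr !gZ IH.
rewrite mulNr addrAC subrr add0r.
case: n => [|n]; first by rewrite sqrtr0 mul0r mulr0.
by rewrite /= eqSS; have [->//|_] := eqVneq m n; rewrite !mulr0.
Qed.

End HermiteOrthonormality.

(** * Parseval's identity for the weighted norm *)

Section Parseval.
Context {R : realType}.
Local Notation mu := (@lebesgue_measure R).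

Lemma gaussm_sum (a : R) (I : Type) (r : seq I) (F : I -> {poly R}) : 0 < a ->
  gaussm a (\sum_(i <- r) F i) = \sum_(i <- r) gaussm a (F i).
Proof.
move=> a0; elim: r => [|i r IH].
  by rewrite !big_nil gaussm0.
by rewrite !big_cons -IH gaussmD.
Qed.

(** The weight cancels one of the two Gaussian factors of the square. What remains is [a] times a
    moment of a squared Hermite expansion, computed by orthonormality. *)
Lemma integral_Psi_sqr (a : R) (N : nat) (c : nat -> R) : 0 < a ->
  (\int[mu]_v (`|\sum_(n < N) c n * Psi n a v| ^+ 2 * omega a v)%:E)%E
  = (a * \sum_(n < N) c n ^+ 2)%:E.
Proof.
move=> a0; pose p := \sum_(n < N) c n *: hermite_poly n : {poly R}.
have gZ d q : gaussm a (d *: q) = d * gaussm a q by exact: gaussmZ.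
have -> : a * \sum_(n < N) c n ^+ 2 = gaussm a (a *: (p * p)).
  rewrite gZ mulr_suml gaussm_sum//; congr (_ * _); apply: eq_bigr => i _.
  rewrite mulr_sumr gaussm_sum// (bigD1 i)//= big1 ?addr0 => [|j ji].
    by rewrite -scalerAl -scalerAr !gZ gaussm_hermite// eqxx mulr1 expr2.
  rewrite -scalerAl -scalerAr !gZ gaussm_hermite//.
  by rewrite [_ == _]eq_sym -[_ == _]/(j == i) (negbTE ji) !mulr0.
rewrite -integral_horner_gaussw//; apply: eq_integral => v _; congr EFin.
have -> : \sum_(n < N) c n * Psi n a v
    = a * (expR (- ((a * v) ^+ 2 / 2)) / Num.sqrt (2 * pi)) * p.[a * v].
  rewrite horner_sum mulr_sumr; apply: eq_bigr => i _.
  by rewrite hornerZ horner_hermite_poly /Psi; ring.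
have s0 : 0 < Num.sqrt (2 * pi) :> R by rewrite sqrtr_gt0 mulr_gt0// pi_gt0.
rewrite real_normK ?num_real// /omega /gaussw hornerZ hornerM expRN.
by field; rewrite !gt_eqF ?expR_gt0.
Qed.

(** Parseval holds at every fixed [x], nodes included; only the remaining integral in [x] is split
    into cells. *)
Lemma omega_norm_mesh (L : R) (Nx : nat) (xh : nat -> R) (a : R) (N : nat)
    (c : nat -> R -> R) (P : nat -> nat -> {poly R}) :
  is_mesh L Nx xh -> 0 < a ->
  (forall n j, (j < Nx)%N -> {in `]xh j, xh j.+1[, forall x, c n x = (P n j).[x]}) ->
  omega_norm L a (fun x v => \sum_(n < N) c n x * Psi n a v)
  = ((a * \sum_(n < N) \sum_(j < Nx) poly_int (xh j) (xh j.+1) (P n j ^+ 2)) `^ 2^-1)%:E.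
Proof.
move=> mesh a0 cP; rewrite /omega_norm.
under eq_integral do rewrite (integral_Psi_sqr _ _ (fun n => c n _))//.
rewrite (integral_mesh _ _ _ mesh _ (fun j => a *: \sum_(n < N) P n j ^+ 2)).
  rewrite poweR_EFin exchange_big mulr_sumr; congr ((_ `^ _)%:E).
  by apply: eq_bigr => j _; rewrite linearZ linear_sum.
move=> j jN x xj; rewrite hornerZ horner_sum; congr (_ * _).
by apply: eq_bigr => n _; rewrite horner_exp (cP n j).
Qed.

End Parseval.

(** * The scaling function *)

Section ScalingDerivative.
Context {R : realType}.
Local Notation mu := (@lebesgue_measure R).
Local Notation time_nbhs t := (within [set s : R | 0 <= s] t^').

(** Extends a function continuous on [[0, +oo[] by its value at 0, so that the integrand defining
    the scaling function is continuous on the whole line. *)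
Lemma continuous_max0 (f : R -> R) :
  (forall t : R, 0 <= t -> f @ time_nbhs t --> f t) ->
  continuous (fun s : R => f (Num.max 0 s)).
Proof.
move=> cf t; apply/cvgrPdist_le => e e0.
have t0 : 0 <= Num.max 0 t by rewrite le_max lexx.
have /cvgrPdist_le/(_ _ e0) := cf _ t0; rewrite /within/= /dnbhs /within/= => H.
have cm : (fun s : R => Num.max 0 s) @ t --> Num.max 0 t.
  by apply: (@continuous_max R R (fun=> 0) id); [exact: cvg_cst | exact: cvg_id].
have := cm _ H; apply: (@filterS _ (nbhs t)) => s /=.
(* The punctured filter gives nothing at the limit point itself, where the difference is 0. *)
have [-> _|st H'] := eqVneq (Num.max 0 s) (Num.max 0 t).
  by rewrite subrr normr0 ltW.
by apply: H' => //; rewrite le_max lexx.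
Qed.

Variables (alpha0 gamma : R) (nE : R -> R).
Hypothesis alpha0_gt0 : 0 < alpha0.
Hypothesis gamma_gt0 : 0 < gamma.
Hypothesis nE_cont : forall t : R, 0 <= t -> nE @ time_nbhs t --> nE t.

Let G (s : R) : R := nE (Num.max 0 s) ^+ 2.
Let I (t : R) : R := \int[mu]_(s in `[0, t]) G s.

Let contG : continuous G.
Proof.
move=> s; apply: (@continuous_comp R R R (fun s => nE (Num.max 0 s)) (fun y : R => y ^+ 2)).
  exact: (continuous_max0 _ nE_cont).
exact: exprn_continuous.
Qed.

Let intG (a b : R) : mu.-integrable `[a, b] (EFin \o G).
Proof.
apply: continuous_compact_integrable; first exact: segment_compact.
by apply: continuous_subspaceT; exact: contG.
Qed.

Let IE t : \int[mu]_(s in `[0, t]) (nE s ^+ 2) = I t.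
Proof.
apply: eq_Rintegral => s; rewrite inE/= in_itv/= => /andP[s0 _].
by rewrite /G (elimT max_idPr s0).
Qed.

Let base_gt0 t : 0 < 1 + gamma * alpha0 ^+ 2 * I t.
Proof.
rewrite ltr_pwDl// mulr_ge0//; first by rewrite mulr_ge0 ?sqr_ge0// ltW.
by apply: Rintegral_ge0 => s _; exact: sqr_ge0.
Qed.

Let a := scaling alpha0 gamma nE.

Let scalingE t : a t = alpha0 * (1 + gamma * alpha0 ^+ 2 * I t) `^ (- 2^-1).
Proof. by rewrite /a /scaling IE. Qed.

Lemma scaling_gt0 t : 0 < a t.
Proof. by rewrite scalingE mulr_gt0// powR_gt0. Qed.

(** The chain rule yields the power [-1/2 - 1 = 3 * (-1/2)], which is the cube of the power in [a];
    the surplus [alpha0 ^+ 2] supplies the rest of [a t ^+ 3]. *)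
Lemma is_ddt_scaling (t : R) : 0 < t ->
  is_ddt a t (- (gamma / 2) * nE t ^+ 2 * a t ^+ 3).
Proof.
move=> t0.
(* Integrating up to [t + 1] makes [t] an interior point. *)
have [dI I'] := @continuous_FTC1_closed R G 0 t (t + 1) ltac:(by rewrite ltrDl) (intG _ _) t0 (contG t).
have DI : is_derive t 1 I (nE t ^+ 2).
  split; first exact: dI.
  by rewrite -derive1E I' /G (elimT max_idPr (ltW t0)).
have DB : is_derive t 1 (fun s => 1 + gamma * alpha0 ^+ 2 * I s) (gamma * alpha0 ^+ 2 * nE t ^+ 2).
  have H := is_deriveZ (gamma * alpha0 ^+ 2) DI.
  have := is_deriveD (is_derive_cst (1 : R) t 1) H; rewrite add0r; exact.
have DP := @is_derive1_comp R (fun y => y `^ (- 2^-1)) (fun s => 1 + gamma * alpha0 ^+ 2 * I s) t _ _ (is_derive1_powR (- 2^-1) (base_gt0 t)) DB.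
have := is_deriveZ alpha0 DP => D.
have : is_derive t 1 a (- (gamma / 2) * nE t ^+ 2 * a t ^+ 3).
  rewrite (_ : a = fun s => alpha0 * (1 + gamma * alpha0 ^+ 2 * I s) `^ (- 2^-1)); last exact/funext/scalingE.
  have P3 : ((1 + gamma * alpha0 ^+ 2 * I t) `^ (- 2^-1)) ^+ 3
      = (1 + gamma * alpha0 ^+ 2 * I t) `^ (- 2^-1 - 1).
    by rewrite -powR_mulrn ?powR_ge0// -powRrM; congr (_ `^ _); field.
  by apply: is_derive_eq; rewrite /GRing.scale/= exprMn P3; field.
exact: is_derive_is_ddt.
Qed.

(** Complements the derivative formula, stated for [t > 0], at the initial time. *)
Lemma scaling_cvg0 : a @ time_nbhs 0 --> a 0.
Proof.
have cI : I @ time_nbhs 0 --> I 0.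
  have := parameterized_integral_continuous ler01 (intG 0 1).
  move=> /(continuous_within_itvP _ ltr01)[_ + _]; rewrite /parameterized_integral.
  apply: cvg_trans; apply: cvg_app => A; rewrite /within/= /at_right /dnbhs /within/=.
  by apply: (@filterS _ (nbhs (0:R))) => s H s0 s1; apply: H; rewrite lt_neqAle eq_sym s0.
rewrite (_ : a = fun s => alpha0 * (1 + gamma * alpha0 ^+ 2 * I s) `^ (- 2^-1)); last exact/funext/scalingE.
apply: cvgM; first exact: cvg_cst.
apply: (@cvg_comp _ _ _ (fun s => 1 + gamma * alpha0 ^+ 2 * I s) (fun y => y `^ (- 2^-1)) _ (nbhs (1 + gamma * alpha0 ^+ 2 * I 0))).
  by apply: cvgD; [exact: cvg_cst | apply: cvgM => //; exact: cvg_cst].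
suff : {for 1 + gamma * alpha0 ^+ 2 * I 0, continuous (fun y : R => y `^ (- 2^-1))} by [].
apply: differentiable_continuous; apply/derivable1_diffP.
by case: (is_derive1_powR (- 2^-1) (base_gt0 0)).
Qed.

End ScalingDerivative.

(** * The estimate on the Hermite modes *)

Section ModalEstimate.
Context {R : realType}.
Implicit Types (c F : nat -> R) (a g e M : R).

Lemma sum_shift N F : F 0%N = 0 -> F N = 0 -> F N.+1 = 0 ->
  \sum_(m < N.+1) F m.+1 = \sum_(n < N) F n.
Proof.
move=> F0 FN FN1; have := @big_ord_recl R 0 +%R N.+1 (fun i => F i).
rewrite /= F0 add0r => <-.
by rewrite big_ord_recr/= FN1 addr0 big_ord_recr/= FN addr0.
Qed.

(** The pointwise form of the estimate: [c n] stands for the value of the n-th mode at a point, [e]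
    for that of the field and [M] for its sup norm. Everything is rewritten in terms of [D], so that
    each index contributes a quadratic form in [D m] and [c m]. *)
Lemma modal_estimate N c a a' g e M : 0 < a -> 0 < g -> `|e| <= M ->
  (forall n, (N <= n)%N -> c n = 0) ->
  a' = - (g / 2) * M ^+ 2 * a ^+ 3 ->
  \sum_(n < N) (a' * c n ^+ 2
    + 2 * a' * (n%:R * c n ^+ 2 + Num.sqrt ((n%:R - 1) * n%:R) * (c (n - 2)%N * c n))
    + 2 * a ^+ 2 * Num.sqrt n%:R * (e * (c (n - 1)%N * c n)))
  <= a / (2 * g) * \sum_(n < N) c n ^+ 2.
Proof.
move=> a0 g0 eM cN a'E.
(* This is D_{m+1} of the overview. [D N] contains [c (N - 1)] and need not vanish, hence the sums
   up to [N.+1]. *)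
pose D m := Num.sqrt m.+1%:R * c m.+1 + Num.sqrt m%:R * c (m - 1)%N.
(* The two squares contribute [n] and [n + 1] to the coefficient of [c n ^+ 2]; the odd unit
   accounts for the derivative of the prefactor alpha of the norm. *)
have DE : \sum_(m < N.+1) D m ^+ 2 = \sum_(n < N)
   (c n ^+ 2 + 2 * (n%:R * c n ^+ 2 + Num.sqrt ((n%:R - 1) * n%:R) * (c (n - 2)%N * c n))).
  pose h n := Num.sqrt ((n%:R - 1) * n%:R) * (c (n - 2)%N * c n).
  pose s n := n%:R * c n ^+ 2.
  have -> : \sum_(m < N.+1) D m ^+ 2
     = \sum_(m < N.+1) s m.+1 + \sum_(m < N.+1) m%:R * c (m - 1)%N ^+ 2
       + 2 * \sum_(m < N.+1) h m.+1.
    rewrite mulr_sumr -!big_split/=; apply: eq_bigr => m _.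
    rewrite /D /s /h sqrrD !exprMn !sqr_sqrtr//= subSS -[m.+1%:R - 1]/(m.+1%:R - 1%:R) -natrB// subSS subn0 sqrtrM//.
    ring.
  rewrite (sum_shift N s) /s ?mul0r ?cN ?expr0n ?mulr0//.
  rewrite (sum_shift N h); first last.
  - by rewrite /h [c N.+1]cN// !mulr0.
  - by rewrite /h [c N]cN// !mulr0.
  - by rewrite /h mulr0 sqrtr0 mul0r.
  rewrite /h.
  rewrite big_ord_recl mul0r add0r mulr_sumr -!big_split/=; apply: eq_bigr => m _.
  by rewrite /bump leq0n add1n subSS subn0 -natr1; ring.
have CE : \sum_(m < N.+1) D m * c m = 2 * \sum_(n < N) Num.sqrt n%:R * (c (n - 1)%N * c n).
  pose s n := Num.sqrt n%:R * (c (n - 1)%N * c n).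
  have -> : \sum_(m < N.+1) D m * c m = \sum_(m < N.+1) s m.+1 + \sum_(m < N.+1) s m.
    by rewrite -big_split/=; apply: eq_bigr => m _; rewrite /D /s subSS subn0; ring.
  rewrite (sum_shift N s); first last.
  - by rewrite /s [c N.+1]cN// !mulr0.
  - by rewrite /s [c N]cN// !mulr0.
  - by rewrite /s sqrtr0 mul0r.
  rewrite /s big_ord_recr/= [c N]cN// !mulr0 addr0.
  by rewrite mulr_natl mulr2n.
have -> : \sum_(n < N) c n ^+ 2 = \sum_(m < N.+1) c m ^+ 2.
  by rewrite big_ord_recr/= cN// expr0n addr0.
have -> : \sum_(n < N) (a' * c n ^+ 2
    + 2 * a' * (n%:R * c n ^+ 2 + Num.sqrt ((n%:R - 1) * n%:R) * (c (n - 2)%N * c n))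
    + 2 * a ^+ 2 * Num.sqrt n%:R * (e * (c (n - 1)%N * c n)))
  = \sum_(m < N.+1) (a' * D m ^+ 2 + a ^+ 2 * e * (D m * c m)).
  rewrite [RHS]big_split/= -!mulr_sumr DE CE mulrCA !mulr_sumr -big_split/=.
  by apply: eq_bigr => n _; ring.
rewrite mulr_sumr; apply: ler_sum => m _.
have e2 : e ^+ 2 <= M ^+ 2 by rewrite -(real_normK (num_real e)) lerXn2r ?nnegrE// (le_trans _ eM).
have h1 : a' * D m ^+ 2 <= - (g / 2) * e ^+ 2 * a ^+ 3 * D m ^+ 2.
  rewrite a'E !mulNr lerN2 ler_wpM2r ?sqr_ge0// ler_wpM2r ?exprn_ge0 ?(ltW a0)//.
  by rewrite ler_wpM2l// divr_ge0// ltW.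
apply: le_trans (lerD h1 (lexx _)) _; rewrite -subr_ge0.
(* Young's inequality as a completed square: the square of [D m] is exactly what [a'] provides, and
   [a / (2 * g)] is the coefficient left on [c m ^+ 2]. *)
rewrite (_ : _ - _ = a / (2 * g) * (c m - g * a * e * D m) ^+ 2).
  by rewrite mulr_ge0 ?sqr_ge0// divr_ge0 ?mulr_ge0 ?ltW.
by field; rewrite gt_eqF.
Qed.

End ModalEstimate.

(** * Broken polynomial spaces *)

Section BrokenPolynomials.
Context {R : realType}.
Local Notation mu := (@lebesgue_measure R).
Local Notation time_nbhs t := (within [set s : R | 0 <= s] t^').
Variables (L : R) (Nx : nat) (xh : nat -> R) (k : nat).
Hypothesis mesh : is_mesh L Nx xh.
Hypothesis L_gt0 : 0 < L.
Implicit Types (p q : nat -> {poly R}) (u : R -> R).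

Let xlt j : (j < Nx)%N -> xh j < xh j.+1 := @mesh_lt _ _ _ _ mesh j.

Lemma mesh_cells_gt0 : (0 < Nx)%N.
Proof.
case: mesh => x0 xL _; rewrite lt0n; apply/eqP => N0.
by move: L_gt0; rewrite -xL N0 x0 ltxx.
Qed.

Definition broken_poly u p := forall j, (j < Nx)%N ->
  {in `]xh j, xh j.+1[, forall x, u x = (p j).[x]}.

(** The cell to the left of node [m] is [m.-1], and by periodicity the last one for node 0. *)
Definition trace_minus p m : R :=
  (p (if m == 0%N then Nx.-1 else m.-1)).[xh (if m == 0%N then Nx else m)].
Definition trace_plus p m : R :=
  (p (if m == Nx then 0%N else m)).[xh (if m == Nx then 0%N else m)].
Definition trace_jump p m : R := trace_plus p m - trace_minus p m.
Definition trace_mean p m : R := 2^-1 * (trace_plus p m + trace_minus p m).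
Definition broken_int p : R := \sum_(j < Nx) poly_int (xh j) (xh j.+1) (p j).

Lemma Vh_broken u : Vh Nx xh k u -> broken_poly u (fun j => cellpoly xh k j u).
Proof.
move=> Vu j jN x xj; have [p sp up] := Vu j jN.
have up' : {in `]xh j, xh j.+1[, forall y, u y = p.[y]}.
  by move=> y yj; apply: up; rewrite inE.
by rewrite (cellpolyE _ _ _ _ _ (xlt _ jN) sp up') up'.
Qed.

Lemma tr_minusE u p m : broken_poly u p -> (m <= Nx)%N ->
  tr_minus Nx xh u m = trace_minus p m.
Proof.
move=> up mN; rewrite /tr_minus /trace_minus; have N0 := mesh_cells_gt0.
case: m mN => [_|m mN] /=.
  rewrite -{1}(prednK N0) (@cell_trace_left _ (xh Nx.-1) _ u (p Nx.-1)) ?prednK//.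
    by rewrite -{2}(prednK N0) xlt ?prednK.
  by have := up Nx.-1; rewrite prednK//; apply; rewrite ?leqnn ?ltn_predL.
exact: cell_trace_left (xlt _ mN) (up _ mN).
Qed.

Lemma tr_plusE u p m : broken_poly u p -> (m <= Nx)%N ->
  tr_plus Nx xh u m = trace_plus p m.
Proof.
move=> up mN; rewrite /tr_plus /trace_plus; have N0 := mesh_cells_gt0.
case: eqVneq => [_|mNx]; first exact: cell_trace_right (xlt _ N0) (up _ N0).
have mlt : (m < Nx)%N by rewrite ltn_neqAle mNx.
exact: cell_trace_right (xlt _ mlt) (up _ mlt).
Qed.

Lemma trace_minus_periodic p : trace_minus p Nx = trace_minus p 0.
Proof. by rewrite /trace_minus eqxx; case: Nx mesh_cells_gt0. Qed.

Lemma trace_plus_periodic p : trace_plus p Nx = trace_plus p 0.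
Proof. by rewrite /trace_plus eqxx; case: eqP. Qed.

(** Cyclic summation by parts: regrouping the contributions by node instead of by cell pairs the two
    traces of [q] at each node, and [X Nx = X 0] closes the cycle. *)
Lemma sum_flux (X : nat -> R) q : X Nx = X 0%N ->
  \sum_(j < Nx) (X j.+1 * (q j).[xh j.+1] - X j * (q j).[xh j])
  = - \sum_(j < Nx) X j * trace_jump q j.
Proof.
move=> XN.
have H : \sum_(j < Nx) X j.+1 * trace_minus q j.+1 = \sum_(j < Nx) X j * trace_minus q j.
  have E1 := @big_ord_recl R 0 +%R Nx (fun i => X i * trace_minus q i).
  have E2 := @big_ord_recr R 0 +%R Nx (fun i => X i * trace_minus q i).
  move: E1; rewrite E2 /= XN trace_minus_periodic addrC => /addrI <-.
  by apply: eq_bigr => i _.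
have -> : \sum_(j < Nx) (X j.+1 * (q j).[xh j.+1] - X j * (q j).[xh j])
    = \sum_(j < Nx) X j.+1 * trace_minus q j.+1 - \sum_(j < Nx) X j * trace_plus q j.
  rewrite -sumrB; apply: eq_bigr => j _; rewrite /trace_minus /trace_plus /=.
  by rewrite (ltn_eqF (ltn_ord j)).
by rewrite H -sumrB -sumrN; apply: eq_bigr => j _; rewrite /trace_jump; ring.
Qed.

Lemma broken_intD p q : broken_int (fun j => p j + q j) = broken_int p + broken_int q.
Proof. by rewrite /broken_int -big_split; apply: eq_bigr => j _; rewrite linearD. Qed.

Lemma broken_intZ c p : broken_int (fun j => c *: p j) = c * broken_int p.
Proof. by rewrite /broken_int mulr_sumr; apply: eq_bigr => j _; rewrite linearZ. Qed.

Lemma broken_int_sum (I : Type) (r : seq I) (F : I -> nat -> {poly R}) :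
  broken_int (fun j => \sum_(i <- r) F i j) = \sum_(i <- r) broken_int (F i).
Proof. by rewrite /broken_int exchange_big; apply: eq_bigr => j _; rewrite linear_sum. Qed.

Lemma eq_broken_int p q : (forall j, (j < Nx)%N -> p j = q j) -> broken_int p = broken_int q.
Proof. by move=> pq; apply: eq_bigr => j _; rewrite pq. Qed.

Lemma broken_int_ge0 p :
  (forall j, (j < Nx)%N -> {in `]xh j, xh j.+1[, forall x, 0 <= (p j).[x]}) -> 0 <= broken_int p.
Proof. by move=> p0; apply: sumr_ge0 => j _; apply: poly_int_ge0; exact: p0. Qed.

(* With central fluxes: the bilinear form B of the header. *)
Definition central p q : R :=
  - broken_int (fun j => p j * (q j)^`()) - \sum_(j < Nx) trace_mean p j * trace_jump q j.

(** The volume terms add up to the integral of [(p q)'], which is minus the sum of the jumps of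
    [p q]; the interface terms cancel it because [[p q] = {p}[q] + {q}[p]]. *)
Lemma central_antisym p q : central p q = - central q p.
Proof.
apply/eqP; rewrite -addr_eq0; apply/eqP.
have IBP : broken_int (fun j => (p j * q j)^`()) = - \sum_(j < Nx) (trace_jump (fun i => p i * q i) j).
  have := sum_flux (fun=> 1) (fun i => p i * q i) erefl.
  under [X in _ = - X -> _]eq_bigr do rewrite mul1r.
  by move=> <-; apply: eq_bigr => j _; rewrite poly_int_deriv ?xlt// !mul1r.
have HI : broken_int (fun j => p j * (q j)^`()) + broken_int (fun j => q j * (p j)^`()) = broken_int (fun j => (p j * q j)^`()).
  by rewrite -broken_intD; apply: eq_broken_int => j _; rewrite derivM; ring.
have HJ : \sum_(j < Nx) trace_mean p j * trace_jump q j + \sum_(j < Nx) trace_mean q j * trace_jump p j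
    = \sum_(j < Nx) trace_jump (fun i => p i * q i) j.
  rewrite -big_split; apply: eq_bigr => j _.
  by rewrite /trace_mean /trace_jump /trace_plus /trace_minus !hornerM /=; field.
rewrite /central addrACA -opprD HI -opprD HJ IBP; ring.
Qed.

Lemma centralDl p1 p2 q :
  central (fun j => p1 j + p2 j) q = central p1 q + central p2 q.
Proof.
have E1 : broken_int (fun j => (p1 j + p2 j) * (q j)^`())
    = broken_int (fun j => p1 j * (q j)^`()) + broken_int (fun j => p2 j * (q j)^`()).
  by rewrite -broken_intD; apply: eq_broken_int => j _; rewrite mulrDl.
have E2 : \sum_(j < Nx) trace_mean (fun j => p1 j + p2 j) j * trace_jump q j
    = \sum_(j < Nx) trace_mean p1 j * trace_jump q j + \sum_(j < Nx) trace_mean p2 j * trace_jump q j.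
  rewrite -big_split; apply: eq_bigr => j _.
  by rewrite /trace_mean /trace_plus /trace_minus !hornerD /=; ring.
by rewrite /central E1 E2; ring.
Qed.

Lemma centralZl c p q : central (fun j => c *: p j) q = c * central p q.
Proof.
rewrite /central mulrBr mulrN -broken_intZ mulr_sumr; congr (- _ - _).
  by apply: eq_broken_int => j _; rewrite scalerAl.
by apply: eq_bigr => j _; rewrite /trace_mean /trace_plus /trace_minus !hornerZ; ring.
Qed.

Lemma central0l q : central (fun=> 0) q = 0.
Proof.
have := centralZl 0 (fun=> 0) q; rewrite mul0r => <-.
by rewrite /central; congr (- _ - _); [apply: eq_broken_int => j _ | apply: eq_bigr => j _];
  rewrite ?scale0r// /trace_mean /trace_plus /trace_minus scale0r.
Qed.

End BrokenPolynomials.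

(** * Time regularity of curves in the broken polynomial space *)

Section BrokenCurves.
Context {R : realType}.
Local Notation time_nbhs t := (within [set s : R | 0 <= s] t^').
Variables (L : R) (Nx : nat) (xh : nat -> R) (k : nat).
Hypothesis mesh : is_mesh L Nx xh.
Hypothesis L_gt0 : 0 < L.
Implicit Types (u v : R -> R -> R) (t : R) (p q : nat -> {poly R}).

Definition curve u t j := cellpoly xh k j (u t).
(** Interpolation commutes with the time derivative, as neither the sample points nor the Lagrange
    basis depends on time; this is the derivative of [curve u]. *)
Definition dcurve u t j := cellpoly xh k j (fun x => ddt (u^~ x) t).

Lemma is_ddtV (f : R -> R) t d : (forall s, f s != 0) -> is_ddt f t d ->
  is_ddt (fun s => (f s)^-1) t (- d / f t ^+ 2).
Proof.
move=> f0 fd; have ct := is_ddt_continuous _ _ _ fd.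
have H : (fun s => - time_quotient f t s * ((f s)^-1 * (f t)^-1)) @ time_nbhs t
    --> - d * ((f t)^-1 * (f t)^-1).
  by apply: cvgM; [exact: cvgN | apply: cvgM; [exact: cvgV | exact: cvg_cst]].
rewrite -invfM -expr2 in H; apply: cvg_trans H; apply: near_eq_cvg.
apply: time_nearW => s _ st; rewrite /time_quotient/=; field.
by rewrite subr_eq0 st !f0.
Qed.

Lemma scalar_sum (f : {poly R} -> R) (I : Type) (r : seq I) (c : I -> R) (l : I -> {poly R}) :
  scalar f -> f (\sum_(i <- r) c i *: l i) = \sum_(i <- r) c i * f (l i).
Proof.
move=> lf; elim: r => [|i r IH]; last by rewrite !big_cons lf IH.
by have := lf (-1) 0 0; rewrite !big_nil scaler0 addr0 mulN1r addNr.
Qed.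

(** Stated for an arbitrary linear functional, so as to cover integrals against a test polynomial
    and point values alike. *)
Lemma is_ddt_curve (f : {poly R} -> R) u j t : scalar f ->
  C1_curve Nx xh k u -> 0 <= t -> (j < Nx)%N ->
  is_ddt (fun s => f (curve u s j)) t (f (dcurve u t j)).
Proof.
move=> lf [_ uC] t0 jN.
have fE (w : R -> R) : f (cellpoly xh k j w)
    = \sum_(i < k.+1) w (sample xh k j i) * f (lagrange k.+1 (sample xh k j))`_i.
  exact: scalar_sum.
rewrite /dcurve fE; apply: (eq_is_ddt _ _ _ _ t0 (fun s _ => esym (fE (u s)))).
apply: is_ddt_sum => i _; apply: is_ddtMr; apply: is_ddt_ddt.
have [] := uC j (sample xh k j i) jN; last by move=> /(_ _ t0).
by rewrite inE; exact: sample_cell (mesh_lt _ _ _ mesh _ jN) (ltn_ord i).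
Qed.

(** Only the first factor is expanded in the Lagrange basis; for each basis element [l i] the second
    is handled by the linear case, with the functional [q |-> f (l i * q)]. *)
Lemma is_ddt_curveM (f : {poly R} -> R) u v j t : scalar f ->
  C1_curve Nx xh k u -> C1_curve Nx xh k v -> 0 <= t -> (j < Nx)%N ->
  is_ddt (fun s => f (curve u s j * curve v s j)) t
    (f (dcurve u t j * curve v t j) + f (curve u t j * dcurve v t j)).
Proof.
move=> lf uC vC t0 jN.
pose l i : {poly R} := (lagrange k.+1 (sample xh k j))`_i.
have fE (w : R -> R) (q : {poly R}) : f (cellpoly xh k j w * q)
    = \sum_(i < k.+1) w (sample xh k j i) * f (l i * q).
  rewrite mulr_suml -scalar_sum//; congr f; apply: eq_bigr => i _.
  by rewrite -scalerAl.
rewrite /dcurve !fE -big_split/=.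
apply: (eq_is_ddt _ _ _ _ t0 (fun s _ => esym (fE (u s) _))).
apply: is_ddt_sum => i _; apply: is_ddtM.
  apply: is_ddt_ddt; have [] := uC.2 j (sample xh k j i) jN; last by move=> /(_ _ t0).
  by rewrite inE; exact: sample_cell (mesh_lt _ _ _ mesh _ jN) (ltn_ord i).
have lf' : scalar (fun q : {poly R} => f (l i * q)).
  by move=> c p q; rewrite mulrDr -scalerAr lf.
exact: (is_ddt_curve (fun q : {poly R} => f (l i * q)) v j t lf').
Qed.

Lemma is_ddt_broken_int u q t : C1_curve Nx xh k u -> 0 <= t ->
  is_ddt (fun s => broken_int Nx xh (fun j => curve u s j * q j)) t
    (broken_int Nx xh (fun j => dcurve u t j * q j)).
Proof.
move=> uC t0; apply: is_ddt_sum => j _.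
have lf : scalar (fun p : {poly R} => poly_int (xh j) (xh j.+1) (p * q j)).
  by move=> c p r; rewrite mulrDl -scalerAl linearP.
exact: (is_ddt_curve (fun p : {poly R} => poly_int (xh j) (xh j.+1) (p * q j)) u j t lf uC t0 (ltn_ord j)).
Qed.

Lemma is_ddt_broken_intM u v t : C1_curve Nx xh k u -> C1_curve Nx xh k v -> 0 <= t ->
  is_ddt (fun s => broken_int Nx xh (fun j => curve u s j * curve v s j)) t
    (broken_int Nx xh (fun j => dcurve u t j * curve v t j)
     + broken_int Nx xh (fun j => curve u t j * dcurve v t j)).
Proof.
move=> uC vC t0; rewrite /broken_int -big_split; apply: is_ddt_sum => j _.
by apply: is_ddt_curveM => // c p r; rewrite linearP.
Qed.

Lemma is_ddt_trace_plus u m t : C1_curve Nx xh k u -> 0 <= t -> (m < Nx)%N ->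
  is_ddt (fun s => trace_plus Nx xh (curve u s) m) t (trace_plus Nx xh (dcurve u t) m).
Proof.
move=> uC t0 mN; rewrite /trace_plus (ltn_eqF mN).
have lf : scalar (fun p : {poly R} => p.[xh m]).
  by move=> c p r; rewrite hornerD hornerZ.
exact: (is_ddt_curve (fun p : {poly R} => p.[xh m]) u m t lf uC t0 mN).
Qed.

Lemma is_ddt_trace_minus u m t : C1_curve Nx xh k u -> 0 <= t -> (m < Nx)%N ->
  is_ddt (fun s => trace_minus Nx xh (curve u s) m) t (trace_minus Nx xh (dcurve u t) m).
Proof.
move=> uC t0 mN; rewrite /trace_minus; move: (xh _) => y.
have lf : scalar (fun p : {poly R} => p.[y]).
  by move=> c p r; rewrite hornerD hornerZ.
apply: (is_ddt_curve (fun p : {poly R} => p.[y]) u _ t lf uC t0).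
case: ifP => _; last exact: leq_ltn_trans (leq_pred m) mN.
by rewrite ltn_predL; exact: leq_ltn_trans mN.
Qed.

Lemma is_ddt_trace_jump u m t : C1_curve Nx xh k u -> 0 <= t -> (m < Nx)%N ->
  is_ddt (fun s => trace_jump Nx xh (curve u s) m) t (trace_jump Nx xh (dcurve u t) m).
Proof.
move=> uC t0 mN; rewrite /trace_jump -mulN1r.
apply: (eq_is_ddt (fun s => trace_plus Nx xh (curve u s) m + -1 * trace_minus Nx xh (curve u s) m)) => //.
  by move=> s _; rewrite mulN1r.
by apply: is_ddtD; [exact: is_ddt_trace_plus | apply: is_ddtMl; exact: is_ddt_trace_minus].
Qed.

Lemma is_ddt_central u q t : C1_curve Nx xh k u -> 0 <= t ->
  is_ddt (fun s => central Nx xh (curve u s) q) t (central Nx xh (dcurve u t) q).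
Proof.
move=> uC t0.
have E p : central Nx xh p q = -1 * broken_int Nx xh (fun j => p j * (q j)^`())
   + -1 * \sum_(j < Nx) trace_mean Nx xh p j * trace_jump Nx xh q j by rewrite !mulN1r.
rewrite E; apply: (eq_is_ddt _ _ _ _ t0 (fun s _ => esym (E (curve u s)))).
apply: is_ddtD; first by apply: is_ddtMl; exact: (is_ddt_broken_int u (fun j => (q j)^`()) t uC t0).
apply: is_ddtMl; apply: is_ddt_sum => j _; apply: is_ddtMr; apply: is_ddtMl.
by apply: is_ddtD; [exact: is_ddt_trace_plus | exact: is_ddt_trace_minus].
Qed.

Lemma horner_le_norm (p : {poly R}) x : 0 <= x <= L ->
  `|p.[x]| <= \sum_(i < size p) `|p`_i| * L ^+ i.
Proof.
move=> /andP[x0 xL]; rewrite horner_coef (le_trans (ler_norm_sum _ _ _))//.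
apply: ler_sum => i _; rewrite normrM ler_wpM2l// normrX ger0_norm//.
by rewrite lerXn2r ?nnegrE// ltW.
Qed.

Lemma cell_bounds j x : (j < Nx)%N -> x \in `]xh j, xh j.+1[ -> 0 <= x <= L.
Proof.
move=> jN /[!in_itv]/= /andP[jx xj].
have /andP[h0 _] := mesh_bounds _ _ _ mesh _ (ltnW jN).
have /andP[_ h1] := mesh_bounds _ _ _ mesh _ jN.
by rewrite (le_trans h0 (ltW jx)) (le_trans (ltW xj) h1).
Qed.

(** A [sup] is an upper bound only for bounded sets; the bound comes from the coefficients of the
    finitely many cell polynomials on [[0, L]]. *)
Lemma supnorm_ub (w : R -> R) j x : Vh Nx xh k w -> (j < Nx)%N ->
  x \in `]xh j, xh j.+1[ -> `|w x| <= supnorm Nx xh w.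
Proof.
move=> Vw jN xj; rewrite /supnorm; apply: sup_upper_bound; last first.
  by exists x => //; exists j.
split; first by exists `|w x|; exists x => //; exists j.
exists (\sum_(j < Nx) \sum_(i < size (cellpoly xh k j w)) `|(cellpoly xh k j w)`_i| * L ^+ i).
move=> _ [y [i /= iN yi] <-].
rewrite (Vh_broken _ _ _ _ mesh _ Vw _ iN y yi).
apply: le_trans (horner_le_norm _ _ (cell_bounds _ _ iN yi)) _.
rewrite (bigD1 (Ordinal iN))//= lerDl sumr_ge0// => l _; apply: sumr_ge0 => m _.
by rewrite mulr_ge0// exprn_ge0// ltW.
Qed.

Lemma supnorm_le (w1 w2 : R -> R) e : Vh Nx xh k w2 ->
  (forall j x, (j < Nx)%N -> x \in `]xh j, xh j.+1[ -> `|w1 x - w2 x| <= e) ->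
  supnorm Nx xh w1 <= supnorm Nx xh w2 + e.
Proof.
move=> Vw we; have N0 := mesh_cells_gt0 _ _ _ mesh L_gt0.
have s0 := sample_cell xh k 0 0 (mesh_lt _ _ _ mesh _ N0) isT.
apply: sup_le_ub.
  by exists `|w1 (sample xh k 0 0)|; exists (sample xh k 0 0) => //; exists 0%N.
move=> _ [y [i /= iN yi] <-].
rewrite -[w1 y](subrK (w2 y)) addrC (le_trans (ler_normD _ _))// lerD//.
  exact: (supnorm_ub _ _ _ Vw iN yi).
exact: we iN yi.
Qed.

(** The sup distance between [u t] and [u s] is at most [D s], a finite combination of increments at
    the sample points, each continuous in time. *)
Lemma supnorm_cvg u t : C1_curve Nx xh k u -> 0 <= t ->
  (fun s => supnorm Nx xh (u s)) @ time_nbhs t --> supnorm Nx xh (u t).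
Proof.
move=> uC t0.
pose l j i : {poly R} := (lagrange k.+1 (sample xh k j))`_i.
pose B j i := \sum_(m < size (l j i)) `|(l j i)`_m| * L ^+ m.
pose D s := \sum_(j < Nx) \sum_(i < k.+1)
  `|u t (sample xh k j i) - u s (sample xh k j i)| * B j i.
have B0 j i : 0 <= B j i.
  by apply: sumr_ge0 => m _; rewrite mulr_ge0// exprn_ge0// ltW.
have uD s j x : 0 <= s -> (j < Nx)%N -> x \in `]xh j, xh j.+1[ -> `|u t x - u s x| <= D s.
  move=> s0 jN xj; have xb := cell_bounds _ _ jN xj.
  rewrite (Vh_broken _ _ _ _ mesh _ (uC.1 _ t0) _ jN x xj).
  rewrite (Vh_broken _ _ _ _ mesh _ (uC.1 _ s0) _ jN x xj) -hornerN -hornerD.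
  rewrite /cellpoly -sumrB horner_sum.
  rewrite /D (bigD1 (Ordinal jN))//= (le_trans (ler_norm_sum _ _ _))// -[leLHS]addr0 lerD//; last first.
    by apply: sumr_ge0 => i _; apply: sumr_ge0 => m _; rewrite mulr_ge0.
  apply: ler_sum => i _; rewrite -scalerBl hornerZ normrM ler_wpM2l//.
  exact: horner_le_norm.
have Dc : D @ time_nbhs t --> 0.
  have D0 : D t = 0.
    by rewrite /D big1// => j _; rewrite big1// => i _; rewrite subrr normr0 mul0r.
  rewrite -[X in _ --> X]D0.
  apply: (cvg_big add_continuous) => j _; apply: (cvg_big add_continuous) => i _; apply: cvgM; last exact: cvg_cst.
  apply: cvg_norm; apply: cvgB; first exact: cvg_cst.
  refine (is_ddt_continuous (fun s => u s (sample xh k j i)) t (ddt (fun s => u s (sample xh k j i)) t) _).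
  apply: is_ddt_ddt.
  have [] := uC.2 j (sample xh k j i) (ltn_ord j); last by move=> /(_ _ t0).
  by rewrite inE; exact: sample_cell (mesh_lt _ _ _ mesh _ (ltn_ord j)) (ltn_ord i).
apply/cvgrPdist_le => e e0.
move/cvgrPdist_le : Dc => /(_ _ e0).
apply: filter_app; apply: time_nearW => s s0 _.
have Ds0 : 0 <= D s.
  by apply: sumr_ge0 => j _; apply: sumr_ge0 => i _; rewrite mulr_ge0.
rewrite sub0r normrN ger0_norm// => De; rewrite ler_distl; apply/andP; split.
  rewrite lerBlDr (le_trans (supnorm_le _ _ _ (uC.1 _ t0) _) (lerD (lexx _) De))// => j x jN xj.
  by rewrite distrC; exact: (uD _ _ _ s0 jN xj).
rewrite (le_trans (supnorm_le _ _ _ (uC.1 _ s0) _) (lerD (lexx _) De))// => j x jN xj.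
exact: (uD _ _ _ s0 jN xj).
Qed.

End BrokenCurves.

(** * The scheme *)

Section Conservation.
Context {R : realType}.
Local Notation mu := (@lebesgue_measure R).
Local Notation time_nbhs t := (within [set s : R | 0 <= s] t^').
Variables (L alpha0 gamma beta : R) (Nx : nat) (xh : nat -> R) (NH k : nat).
Variables (C : nat -> R -> R -> R) (E Phi : R -> R -> R) (rho0 : R -> R).
Hypotheses (L_gt0 : 0 < L) (mesh : is_mesh L Nx xh) (NH_ge3 : (3 <= NH)%N).
Hypotheses (alpha0_gt0 : 0 < alpha0) (gamma_gt0 : 0 < gamma).
Hypothesis sol : dg_solution L Nx xh NH k alpha0 gamma beta C E Phi rho0.
Implicit Types (t : R) (q : nat -> {poly R}) (n j m : nat).

Local Notation a := (alpha Nx xh alpha0 gamma E).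
Local Notation P n := (curve xh k (C n)).
Local Notation dP n := (dcurve xh k (C n)).
Local Notation PE := (curve xh k E).
Local Notation dPE := (dcurve xh k E).
Local Notation PF := (curve xh k Phi).
Local Notation dPF := (dcurve xh k Phi).
Local Notation I j := (poly_int (xh j) (xh j.+1)).
Local Notation int := (broken_int Nx xh).
Local Notation form := (central Nx xh).
Local Notation jump := (trace_jump Nx xh).
Local Notation size_le q := (forall j, (size (q j : {poly R}) <= k.+1)%N).

(** Covers the truncated modes too, since the recurrences for the last modes refer to them. *)
Lemma C_C1 n : C1_curve Nx xh k (C n).
Proof.
have [nN|Nn] := ltnP n NH; first exact: sol_C sol n nN.
have C0 t x : C n t x = 0 by exact: (sol_trunc sol t x Nn).
split=> [t _ j jN|j x jN xj].
  by exists 0; rewrite ?size_poly0// => x _; rewrite C0 horner0.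
have -> : (fun t => C n t x) = fun=> 0 by apply/funext => t; rewrite C0.
have d0 t : 0 <= t -> ddt (fun=> 0 : R) t = 0.
  by move=> t0; apply: is_ddtE => //; exact: is_ddt_cst.
split; first by move=> t _; exact: is_ddt_derivable (is_ddt_cst 0 t).
apply: (@subspace_eq_continuous _ _ _ (fun=> 0)); last exact: cst_continuous.
move=> t; rewrite inE/= => t0.
by apply/esym; exact: d0.
Qed.

Let size_curve (u : R -> R -> R) t : size_le (curve xh k u t).
Proof. by move=> j; exact: size_cellpoly. Qed.

Let size_dcurve (u : R -> R -> R) t : size_le (dcurve xh k u t).
Proof. by move=> j; exact: size_cellpoly. Qed.

Lemma broken_curve u t : C1_curve Nx xh k u -> 0 <= t ->
  broken_poly Nx xh (u t) (curve xh k u t).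
Proof. by move=> uC t0; apply: (Vh_broken _ _ _ _ mesh); exact: uC.1. Qed.

Lemma curve_trunc n t j : (NH <= n)%N -> P n t j = 0.
Proof.
move=> Nn; rewrite /curve /cellpoly big1// => i _.
by rewrite (sol_trunc sol _ _ Nn) scale0r.
Qed.

(** * Weak forms summed over the cells *)

Let flux_poly n t j : {poly R} := (a t)^-1 *:
  (Num.sqrt n.+1%:R *: P n.+1 t j + Num.sqrt n%:R *: P (n - 1)%N t j).

Let broken_flux n t : 0 <= t -> broken_poly Nx xh (flux_fun Nx xh alpha0 gamma C E n t) (flux_poly n t).
Proof.
move=> t0 j jN x xj; rewrite /flux_fun /flux_poly !hornerE; congr (_ * (_ * _ + _ * _)).
  exact: broken_curve (C_C1 _) t0 _ jN x xj.
exact: broken_curve (C_C1 _) t0 _ jN x xj.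
Qed.

(** The equation of a cell involves the test function on that cell only, so cell [j] can be tested
    with the single global polynomial [q j]; no function glued from pieces is built. *)
Let Vh_horner (q : {poly R}) : (size q <= k.+1)%N -> Vh Nx xh k (horner q).
Proof. by move=> sq j jN; exists q. Qed.

Let tr_minus_horner (q : {poly R}) j : (j < Nx)%N -> tr_minus Nx xh (horner q) j.+1 = q.[xh j.+1].
Proof. by move=> jN; rewrite (tr_minusE _ _ _ mesh L_gt0 _ (fun=> q)). Qed.

Let tr_plus_horner (q : {poly R}) j : (j < Nx)%N -> tr_plus Nx xh (horner q) j = q.[xh j].
Proof.
move=> jN; rewrite (tr_plusE _ _ _ mesh L_gt0 _ (fun=> q))// ?(ltnW jN)//.
by rewrite /trace_plus (ltn_eqF jN).
Qed.

Let cell_int (f : R -> R) (p : {poly R}) j : (j < Nx)%N ->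
  {in `]xh j, xh j.+1[, forall x, f x = p.[x]} ->
  \int[mu]_(x in cell xh j) f x = I j p.
Proof. by move=> jN; exact: Rintegral_cell. Qed.

(** The flux splits into a mean and a penalization. Linearity turns the volume term and the mean
    into values of [central], leaving the penalization as a separate sum of products of jumps. *)
Lemma vlasov_weak n t q : (n < NH)%N -> 0 <= t -> size_le q ->
  int (fun j => dP n t j * q j)
  - ddt a t / a t * int (fun j => (n%:R *: P n t j
        + Num.sqrt ((n%:R - 1) * n%:R) *: P (n - 2)%N t j) * q j)
  + (a t)^-1 * (Num.sqrt n.+1%:R * form (P n.+1 t) q + Num.sqrt n%:R * form (P (n - 1)%N t) q)
  + 2^-1 * delta Nx xh NH alpha0 gamma E n t * \sum_(j < Nx) jump (P n t) j * jump q j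
  - a t * Num.sqrt n%:R * int (fun j => PE t j * P (n - 1)%N t j * q j) = 0.
Proof.
move=> nN t0 sq.
pose nf m := trace_mean Nx xh (flux_poly n t) m - 2^-1 * delta Nx xh NH alpha0 gamma E n t * jump (P n t) m.
have nfE m : (m <= Nx)%N -> num_flux Nx xh NH alpha0 gamma C E n t m = nf m.
  move=> mN; rewrite /num_flux /nf /trace_mean /trace_jump.
  rewrite (tr_minusE _ _ _ mesh L_gt0 _ _ _ (broken_flux n t t0) mN).
  rewrite (tr_plusE _ _ _ mesh L_gt0 _ _ _ (broken_flux n t t0) mN).
  rewrite (tr_minusE _ _ _ mesh L_gt0 _ _ _ (broken_curve _ _ (C_C1 n) t0) mN).
  rewrite (tr_plusE _ _ _ mesh L_gt0 _ _ _ (broken_curve _ _ (C_C1 n) t0) mN).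
  ring.
have cellE j : (j < Nx)%N ->
   I j (dP n t j * q j)
   - ddt a t / a t * I j ((n%:R *: P n t j + Num.sqrt ((n%:R - 1) * n%:R) *: P (n - 2)%N t j) * q j)
   + (- I j (flux_poly n t j * (q j)^`()) + (nf j.+1 * (q j).[xh j.+1] - nf j * (q j).[xh j]))
   - a t * Num.sqrt n%:R * I j (PE t j * P (n - 1)%N t j * q j) = 0.
  move=> jN; have := sol_vlasov sol nN t0 jN (Vh_horner _ (sq j)).
  rewrite /vlasov_eq /dg_form nfE// nfE ?(ltnW jN)// tr_minus_horner// tr_plus_horner//.
  have -> : ddt (fun s => \int[mu]_(x in cell xh j) (C n s x * (q j).[x])) t = I j (dP n t j * q j).
    apply: is_ddtE => //.
    have lf : scalar (fun p : {poly R} => I j (p * q j)).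
      by move=> c p r; rewrite mulrDl -scalerAl linearP.
    apply: eq_is_ddt (is_ddt_curve _ _ _ _ mesh (fun p : {poly R} => I j (p * q j)) _ _ _ lf (C_C1 n) t0 jN) => // s s0.
    by apply/esym/cell_int => // x xj; rewrite hornerM (broken_curve _ _ (C_C1 n) s0 _ jN x xj).
  rewrite (cell_int _ ((n%:R *: P n t j + Num.sqrt ((n%:R - 1) * n%:R) *: P (n - 2)%N t j) * q j) _ jN); last first.
    move=> x xj; rewrite hornerM hornerD !hornerZ.
    by rewrite (broken_curve _ _ (C_C1 n) t0 _ jN x xj) (broken_curve _ _ (C_C1 (n - 2)%N) t0 _ jN x xj).
  rewrite (cell_int _ (flux_poly n t j * (q j)^`()) _ jN); last first.
    by move=> x xj; rewrite hornerM (broken_flux _ _ t0 _ jN x xj) derivE.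
  rewrite (cell_int _ (PE t j * P (n - 1)%N t j * q j) _ jN); last first.
    move=> x xj; rewrite !hornerM (broken_curve _ _ (sol_E sol) t0 _ jN x xj).
    by rewrite (broken_curve _ _ (C_C1 (n - 1)%N) t0 _ jN x xj).
  by rewrite !addrA.
have /esym Z : \sum_(j < Nx) (I j (dP n t j * q j)
   - ddt a t / a t * I j ((n%:R *: P n t j + Num.sqrt ((n%:R - 1) * n%:R) *: P (n - 2)%N t j) * q j)
   + (- I j (flux_poly n t j * (q j)^`()) + (nf j.+1 * (q j).[xh j.+1] - nf j * (q j).[xh j]))
   - a t * Num.sqrt n%:R * I j (PE t j * P (n - 1)%N t j * q j)) = 0.
  by rewrite big1// => j _; exact: cellE.
have nfp : nf Nx = nf 0%N.
  by rewrite /nf /trace_mean /trace_jump !(trace_minus_periodic _ _ _ mesh L_gt0) !trace_plus_periodic.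
rewrite [RHS]Z sumrB big_split/= sumrB big_split/= (sum_flux _ _ _ mesh L_gt0)// sumrN -!mulr_sumr.
rewrite -!/(int _) -(centralZl _ _ _ _ _) -(centralZl _ _ _ _ _) -centralDl -centralZl.
rewrite -/(flux_poly n t) /central.
have -> : \sum_(j < Nx) nf j * jump q j = \sum_(j < Nx) trace_mean Nx xh (flux_poly n t) j * jump q j
    - 2^-1 * delta Nx xh NH alpha0 gamma E n t * \sum_(j < Nx) jump (P n t) j * jump q j.
  by rewrite mulr_sumr -sumrB; apply: eq_bigr => j _; rewrite /nf; ring.
by rewrite /flux_poly /broken_int; ring.
Qed.

Lemma potential_weak t q : 0 <= t -> size_le q ->
  - form (PF t) q = int (fun j => PE t j * q j).
Proof.
move=> t0 sq.
pose nf m := trace_mean Nx xh (PF t) m.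
have nfE m : (m <= Nx)%N -> Phi_flux Nx xh Phi t m = nf m.
  move=> mN; rewrite /Phi_flux /avg /nf /trace_mean.
  rewrite (tr_minusE _ _ _ mesh L_gt0 _ _ _ (broken_curve _ _ (sol_Phi sol) t0) mN).
  by rewrite (tr_plusE _ _ _ mesh L_gt0 _ _ _ (broken_curve _ _ (sol_Phi sol) t0) mN).
have cellE j : (j < Nx)%N ->
   I j (PE t j * q j)
   = I j (PF t j * (q j)^`()) - (nf j.+1 * (q j).[xh j.+1] - nf j * (q j).[xh j]).
  move=> jN; have := sol_potential sol t0 jN (Vh_horner _ (sq j)).
  rewrite /potential_eq nfE// nfE ?(ltnW jN)// tr_minus_horner// tr_plus_horner//.
  rewrite (cell_int _ (PF t j * (q j)^`()) _ jN); last first.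
    by move=> x xj; rewrite hornerM (broken_curve _ _ (sol_Phi sol) t0 _ jN x xj) derivE.
  rewrite (cell_int _ (PE t j * q j) _ jN); last first.
    by move=> x xj; rewrite hornerM (broken_curve _ _ (sol_E sol) t0 _ jN x xj).
  by move=> <-; ring.
rewrite [RHS]/broken_int (eq_bigr _ (fun (j : 'I_Nx) _ => cellE j (ltn_ord j))) sumrB (sum_flux _ _ _ mesh L_gt0)//.
  by rewrite /central /broken_int; ring.
by rewrite /nf /trace_mean (trace_minus_periodic _ _ _ mesh L_gt0) trace_plus_periodic.
Qed.

Lemma gauss_weak t q : 0 <= t -> size_le q ->
  form (PE t) q + beta * \sum_(j < Nx) jump (PF t) j * jump q j
  = int (fun j => P 0%N t j * q j) - rho0 t * int q.
Proof.
move=> t0 sq.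
pose nf m := trace_mean Nx xh (PE t) m - beta * jump (PF t) m.
have nfE m : (m <= Nx)%N -> E_flux Nx xh beta E Phi t m = nf m.
  move=> mN; rewrite /E_flux /avg /Defs.jump /nf /trace_mean /trace_jump.
  rewrite (tr_minusE _ _ _ mesh L_gt0 _ _ _ (broken_curve _ _ (sol_Phi sol) t0) mN).
  rewrite (tr_plusE _ _ _ mesh L_gt0 _ _ _ (broken_curve _ _ (sol_Phi sol) t0) mN).
  rewrite (tr_minusE _ _ _ mesh L_gt0 _ _ _ (broken_curve _ _ (sol_E sol) t0) mN).
  by rewrite (tr_plusE _ _ _ mesh L_gt0 _ _ _ (broken_curve _ _ (sol_E sol) t0) mN).
have cellE j : (j < Nx)%N ->
   I j (P 0%N t j * q j) - rho0 t * I j (q j)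
   = - I j (PE t j * (q j)^`()) + (nf j.+1 * (q j).[xh j.+1] - nf j * (q j).[xh j]).
  move=> jN; have := sol_gauss sol t0 jN (Vh_horner _ (sq j)).
  rewrite /gauss_eq nfE// nfE ?(ltnW jN)// tr_minus_horner// tr_plus_horner//.
  rewrite (cell_int _ (PE t j * (q j)^`()) _ jN); last first.
    by move=> x xj; rewrite hornerM (broken_curve _ _ (sol_E sol) t0 _ jN x xj) derivE.
  rewrite (cell_int _ (P 0%N t j * q j - rho0 t *: q j) _ jN); last first.
    move=> x xj; rewrite hornerD hornerN hornerM hornerZ (broken_curve _ _ (C_C1 0) t0 _ jN x xj).
    by rewrite mulrBl.
  have -> : I j (P 0%N t j * q j - rho0 t *: q j) = I j (P 0%N t j * q j) - rho0 t * I j (q j).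
    by rewrite linearB linearZ.
  by move=> <-; rewrite addrA.
have -> : int (fun j => P 0%N t j * q j) - rho0 t * int q
    = \sum_(j < Nx) (I j (P 0%N t j * q j) - rho0 t * I j (q j)).
  by rewrite sumrB -mulr_sumr.
rewrite (eq_bigr _ (fun (j : 'I_Nx) _ => cellE j (ltn_ord j))) big_split/= (sum_flux _ _ _ mesh L_gt0)//; last first.
  by rewrite /nf /trace_mean /trace_jump !(trace_minus_periodic _ _ _ mesh L_gt0) !trace_plus_periodic.
rewrite sumrN /central -/(int _).
have -> : \sum_(j < Nx) nf j * jump q j = \sum_(j < Nx) trace_mean Nx xh (PE t) j * jump q j
    - beta * \sum_(j < Nx) jump (PF t) j * jump q j.
  by rewrite mulr_sumr -sumrB; apply: eq_bigr => j _; rewrite /nf; ring.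
by rewrite /broken_int; ring.
Qed.

(** * Conservation of mass and the background density *)

Let size1 (j : nat) : (size (1%R : {poly R}) <= k.+1)%N.
Proof. by rewrite size_poly1. Qed.

Lemma central_1r p : form p (fun=> 1) = 0.
Proof.
rewrite /central /broken_int !big1 ?oppr0 ?addr0// => j _.
  by rewrite /trace_jump /trace_plus /trace_minus !hornerC subrr mulr0.
by rewrite derivC mulr0 linear0.
Qed.

Lemma trace_jump_1 j : jump (fun=> 1) j = 0.
Proof. by rewrite /trace_jump /trace_plus /trace_minus !hornerC subrr. Qed.

Lemma int_1r p : int (fun j => p j * 1) = int p.
Proof. by apply: eq_broken_int => j _; rewrite mulr1. Qed.

Lemma mass_dot t : 0 <= t -> int (dP 0%N t) = 0.
Proof.
move=> t0; have := vlasov_weak 0%N t (fun=> 1) (ltn_trans (ltn0Sn 1) NH_ge3) t0 size1.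
rewrite !central_1r sqrtr0 !mulr0 !mul0r subr0 !addr0 !mulr0 addr0 int_1r.
have -> : int (fun j => (0 *: P 0%N t j + Num.sqrt 0 *: P (0 - 2)%N t j) * 1) = 0.
  by rewrite /broken_int big1// => j _; rewrite sqrtr0 !scale0r addr0 mul0r linear0.
by rewrite mulr0 subr0.
Qed.

Let is_ddt_int (u : R -> R -> R) t : C1_curve Nx xh k u -> 0 <= t ->
  is_ddt (fun s => int (curve xh k u s)) t (int (dcurve xh k u t)).
Proof.
move=> uC t0; rewrite -int_1r; apply: (eq_is_ddt _ _ _ _ t0 (fun s _ => int_1r (curve xh k u s))).
exact: is_ddt_broken_int mesh _ (fun=> 1) _ uC t0.
Qed.

Lemma massE t : 0 <= t -> mass L C t = int (P 0%N t).
Proof.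
move=> t0; apply: (Rintegral_mesh _ _ _ mesh).
exact: broken_curve _ _ (C_C1 0) t0.
Qed.

Lemma is_ddt_mass t : 0 <= t -> is_ddt (mass L C) t 0.
Proof.
move=> t0; rewrite -(mass_dot t t0).
apply: (eq_is_ddt _ _ _ _ t0 (fun s s0 => esym (massE s s0))).
exact: is_ddt_int (C_C1 0) t0.
Qed.

Lemma int_mass_const t : 0 <= t -> int (P 0%N t) = int (P 0%N 0).
Proof.
apply: (is_ddt_constant (fun s => int (P 0%N s))).
  exact: is_ddt_continuous (is_ddt_int _ _ (C_C1 0) (lexx 0)).
by move=> s s0; rewrite -(mass_dot s (ltW s0)); exact: is_ddt_int (C_C1 0) (ltW s0).
Qed.

Lemma int_1 : int (fun=> 1) = L.
Proof.
have [x0 xL _] := mesh; rewrite -xL -[RHS]subr0 -x0 -telescope_sumr// big_mkord.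
apply: eq_bigr => j _; rewrite -derivX poly_int_deriv ?hornerX//.
exact: mesh_lt _ _ _ mesh _ (ltn_ord j).
Qed.

(** Neutrality gives [rho0 t * L] as the mass, which is conserved. *)
Lemma rho0_const t : 0 <= t -> rho0 t = rho0 0.
Proof.
have rE s : 0 <= s -> rho0 s * L = int (P 0%N s).
  move=> s0; apply/eqP; rewrite eq_sym -subr_eq0 -int_1; apply/eqP.
  rewrite -[RHS](sol_rho0 sol s0).
  have -> : int (P 0%N s) - rho0 s * int (fun=> 1) = int (fun j => P 0%N s j + (- rho0 s) *: 1).
    by rewrite broken_intD broken_intZ mulNr.
  apply/esym; apply: (Rintegral_mesh _ _ _ mesh) => j jN x xj; rewrite hornerD hornerZ hornerC mulr1.
  by rewrite (broken_curve _ _ (C_C1 0) s0 _ jN x xj).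
move=> t0; apply: (@mulIf _ L); first by rewrite gt_eqF.
by rewrite !rE ?int_mass_const.
Qed.

(** Both sides of the Gauss equation are differentiated separately and identified by uniqueness of
    [ddt]; constancy of [rho0] removes the background term. *)
Lemma gauss_dot t q : 0 <= t -> size_le q ->
  form (dPE t) q + beta * \sum_(j < Nx) jump (dPF t) j * jump q j
  = int (fun j => dP 0%N t j * q j).
Proof.
move=> t0 sq.
have D1 : is_ddt (fun s => form (PE s) q + beta * \sum_(j < Nx) jump (PF s) j * jump q j) t
    (form (dPE t) q + beta * \sum_(j < Nx) jump (dPF t) j * jump q j).
  apply: is_ddtD; first exact: is_ddt_central mesh _ _ _ (sol_E sol) t0.
  apply: is_ddtMl; apply: is_ddt_sum => j _; apply: is_ddtMr.
  exact: is_ddt_trace_jump mesh _ _ _ (sol_Phi sol) t0 (ltn_ord j).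
have D2 : is_ddt (fun s => int (fun j => P 0%N s j * q j) + (- (rho0 0 * int q))) t
    (int (fun j => dP 0%N t j * q j) + 0).
  apply: is_ddtD; last exact: is_ddt_cst.
  exact: is_ddt_broken_int mesh _ _ _ (C_C1 0) t0.
rewrite -(is_ddtE _ _ _ t0 D1) -[RHS]addr0 -(is_ddtE _ _ _ t0 D2).
apply: is_ddtE => //; apply: eq_is_ddt (is_ddt_ddt _ _ (is_ddt_derivable _ _ _ D2)) => // s s0.
by rewrite gauss_weak// (rho0_const s).
Qed.

(** * The scaling function of the solution and the total energy *)

Let nE s := supnorm Nx xh (E s).

Let nE_cont t : 0 <= t -> nE @ time_nbhs t --> nE t.
Proof. exact: supnorm_cvg mesh L_gt0 _ _ (sol_E sol). Qed.

Lemma alpha_gt0 t : 0 < a t.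
Proof. exact: scaling_gt0. Qed.

Lemma is_ddt_alpha t : 0 < t -> is_ddt a t (- (gamma / 2) * nE t ^+ 2 * a t ^+ 3).
Proof. exact: is_ddt_scaling. Qed.

Lemma alpha_cvg0 : a @ time_nbhs 0 --> a 0.
Proof. exact: scaling_cvg0. Qed.

(** The total energy in terms of cell polynomials, with squares written as products to suit the
    product rule. *)
Let energy t : R :=
  2^-1 * ((a t * a t)^-1 * (Num.sqrt 2 * int (P 2%N t) + int (P 0%N t))
     + int (fun j => PE t j * PE t j))
  + 2^-1 * beta * \sum_(j < Nx) jump (PF t) j * jump (PF t) j.

Lemma total_energyE t : 0 <= t ->
  total_energy L Nx xh alpha0 gamma beta C E Phi t = energy t.
Proof.
move=> t0; rewrite /total_energy /energy; congr (_ * _ + _ * _).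
  have -> : (a t * a t)^-1 * (Num.sqrt 2 * int (P 2%N t) + int (P 0%N t))
      + int (fun j => PE t j * PE t j)
    = int (fun j => (a t * a t)^-1 *: (Num.sqrt 2 *: P 2%N t j + P 0%N t j) + PE t j * PE t j).
    by rewrite broken_intD broken_intZ broken_intD broken_intZ.
  apply: (Rintegral_mesh _ _ _ mesh) => j jN x xj; rewrite hornerD hornerZ hornerD hornerZ hornerM.
  rewrite -(broken_curve _ _ (C_C1 2) t0 _ jN x xj).
  rewrite -(broken_curve _ _ (C_C1 0) t0 _ jN x xj).
  rewrite -(broken_curve _ _ (sol_E sol) t0 _ jN x xj).
  by rewrite real_normK ?num_real// !expr2.
apply: eq_bigr => j _; rewrite /Defs.jump expr2.
rewrite (tr_minusE _ _ _ mesh L_gt0 _ _ _ (broken_curve _ _ (sol_Phi sol) t0) (ltnW (ltn_ord j))).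
by rewrite (tr_plusE _ _ _ mesh L_gt0 _ _ _ (broken_curve _ _ (sol_Phi sol) t0) (ltnW (ltn_ord j))).
Qed.

(** The left side is [central (dPE) (PF)] plus jumps, which the differentiated Gauss equation turns
    into the integral of [dP 0 * PF]. The equation for mode 0 and a second use of antisymmetry bring
    back the field. *)
Lemma field_energy_dot t : 0 <= t ->
  int (fun j => PE t j * dPE t j) + beta * \sum_(j < Nx) jump (PF t) j * jump (dPF t) j
  = - ((a t)^-1 * int (fun j => PE t j * P 1%N t j)).
Proof.
move=> t0; have NH_gt0 : (0 < NH)%N by exact: ltn_trans NH_ge3.
have gauss_t := gauss_dot t _ t0 (size_curve Phi t).
have V := vlasov_weak 0%N t _ NH_gt0 t0 (size_curve Phi t).
have F1 := potential_weak t _ t0 (size_curve (C 1%N) t).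
have F2 := potential_weak t _ t0 (size_dcurve E t).
have A1 := central_antisym _ _ _ mesh L_gt0 (PF t) (dPE t).
have A2 := central_antisym _ _ _ mesh L_gt0 (PF t) (P 1%N t).
rewrite -F1 -F2 A1 A2 !opprK.
have -> : \sum_(j < Nx) jump (PF t) j * jump (dPF t) j = \sum_(j < Nx) jump (dPF t) j * jump (PF t) j.
  by apply: eq_bigr => j _; rewrite mulrC.
rewrite gauss_t; apply/eqP; rewrite -addr_eq0; apply/eqP.
(* Mode 0 carries no penalization; otherwise products of the jumps of C_0 and Phi would remain. *)
move: V; rewrite (_ : delta _ _ _ _ _ _ _ _ = 0)// sqrtr0 sqrtr1 !mulr0 !mul0r mul1r !addr0 subr0.
have -> : int (fun j => (0%:R *: P 0%N t j + Num.sqrt 0 *: P (0 - 2)%N t j) * PF t j) = 0.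
  by rewrite /broken_int big1// => j _; rewrite sqrtr0 !scale0r addr0 mul0r linear0.
by rewrite mulr0 subr0.
Qed.

(** [NH_ge3] ensures that mode 2 has its own equation. Tested with 1, it loses its fluxes and its
    penalization, since a constant has no jumps. *)
Lemma second_moment_dot t : 0 <= t ->
  int (dP 2%N t) = ddt a t / a t * (2 * int (P 2%N t) + Num.sqrt 2 * int (P 0%N t))
    + a t * Num.sqrt 2 * int (fun j => PE t j * P 1%N t j).
Proof.
move=> t0; have := vlasov_weak 2%N t (fun=> 1) NH_ge3 t0 size1.
rewrite !central_1r !mulr0 addr0 mulr0 addr0 int_1r int_1r int_1r.
rewrite (_ : \sum_(j < Nx) jump (P 2%N t) j * jump (fun=> 1) j = 0); last first.
  by rewrite big1// => j _; rewrite trace_jump_1 mulr0.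
rewrite mulr0 addr0 broken_intD !broken_intZ (_ : (2%:R - 1) * 2%:R = 2 :> R); last by ring.
by move=> H; apply/eqP; rewrite -subr_eq0 -[X in _ == X]H; apply/eqP; ring.
Qed.

(** The derivative of [alpha ^- 2] cancels the [alpha'] terms of the second moment, as
    [sqrt 2 * sqrt 2 = 2]; the work of the field on mode 1 then balances the field energy. *)
Lemma is_ddt_energy t : 0 < t -> is_ddt energy t 0.
Proof.
move=> t0; have t0' := ltW t0; have at0 := alpha_gt0 t.
have aD : is_ddt a t (ddt a t).
  by apply: is_ddt_ddt; exact: is_ddt_derivable (is_ddt_alpha t t0).
have aV := is_ddtV (fun s => a s * a s) t _ (fun s => lt0r_neq0 (mulr_gt0 (alpha_gt0 s) (alpha_gt0 s)))
  (is_ddtM _ _ _ _ _ aD aD).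
have D2 := is_ddtD _ _ _ _ _ (is_ddtMl (Num.sqrt 2) _ _ _ (is_ddt_int _ _ (C_C1 2) t0')) (is_ddt_int _ _ (C_C1 0) t0').
have DE := is_ddt_broken_intM _ _ _ _ mesh _ _ _ (sol_E sol) (sol_E sol) t0'.
have DJ : is_ddt (fun s => \sum_(j < Nx) jump (PF s) j * jump (PF s) j) t
    (\sum_(j < Nx) (jump (dPF t) j * jump (PF t) j + jump (PF t) j * jump (dPF t) j)).
  by apply: is_ddt_sum => j _; apply: is_ddtM; exact: is_ddt_trace_jump mesh _ _ _ (sol_Phi sol) t0' (ltn_ord j).
have := is_ddtD _ _ _ _ _ (is_ddtMl 2^-1 _ _ _ (is_ddtD _ _ _ _ _ (is_ddtM _ _ _ _ _ aV D2) DE))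
  (is_ddtMl (2^-1 * beta) _ _ _ DJ).
rewrite [X in is_ddt _ _ X -> _](_ : _ = 0)//.
rewrite mass_dot// second_moment_dot//.
have -> : int (fun j => dPE t j * PE t j) = int (fun j => PE t j * dPE t j).
  by apply: eq_broken_int => j _; rewrite mulrC.
have -> : \sum_(j < Nx) (jump (dPF t) j * jump (PF t) j + jump (PF t) j * jump (dPF t) j)
    = 2 * \sum_(j < Nx) jump (PF t) j * jump (dPF t) j.
  by rewrite mulr_sumr; apply: eq_bigr => j _; ring.
have FE := field_energy_dot t t0'.
have rr : Num.sqrt 2 * Num.sqrt 2 = 2 :> R by rewrite -expr2 sqr_sqrtr.
move: (int (P 2%N t)) (int (P 0%N t)) FE (Num.sqrt 2) rr (ddt a t) => M2 M0.
move: (int (fun j => PE t j * P 1%N t j)) (int (fun j => PE t j * dPE t j)).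
move: (\sum_(j < Nx) jump (PF t) j * jump (dPF t) j) => J EC EE FE r rr a'.
have E1 : r * (a' / a t * (2 * M2 + r * M0) + a t * r * EC)
    = a' / a t * (2 * r * M2 + r * r * M0) + a t * (r * r) * EC by ring.
rewrite addr0 E1 rr; have {FE} -> : EE = - ((a t)^-1 * EC) - beta * J by rewrite -FE addrK.
by field; rewrite gt_eqF.
Qed.

(** Continuity at 0 is checked term by term, [alpha] being handled by [alpha_cvg0] there. *)
Lemma energy_const t : 0 <= t ->
  total_energy L Nx xh alpha0 gamma beta C E Phi t
  = total_energy L Nx xh alpha0 gamma beta C E Phi 0.
Proof.
move=> t0; rewrite !total_energyE//; apply: (is_ddt_constant energy) => //; last exact: is_ddt_energy.
have c u : C1_curve Nx xh k u -> (fun s => int (curve xh k u s)) @ time_nbhs 0 --> int (curve xh k u 0).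
  by move=> uC; exact: is_ddt_continuous (is_ddt_int _ _ uC (lexx 0)).
apply: cvgD; last first.
  apply: cvgM; first exact: cvg_cst.
  apply: (is_ddt_continuous (fun s => \sum_(j < Nx) jump (PF s) j * jump (PF s) j) 0
    (\sum_(j < Nx) (jump (dPF 0) j * jump (PF 0) j + jump (PF 0) j * jump (dPF 0) j))).
  by apply: is_ddt_sum => j _; apply: is_ddtM; exact: is_ddt_trace_jump mesh _ _ _ (sol_Phi sol) (lexx 0) (ltn_ord j).
apply: cvgM; first exact: cvg_cst.
apply: cvgD; last exact: is_ddt_continuous (is_ddt_broken_intM _ _ _ _ mesh _ _ _ (sol_E sol) (sol_E sol) (lexx 0)).
apply: cvgM.
  by apply: cvgV; [rewrite mulf_neq0 ?gt_eqF ?alpha_gt0 | apply: cvgM; exact: alpha_cvg0].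
apply: cvgD; last exact: (c _ (C_C1 0)).
by apply: cvgM; [exact: cvg_cst | exact: (c _ (C_C1 2))].
Qed.

(** * The weighted norm *)

Lemma transport_cancel t :
  \sum_(n < NH) (Num.sqrt n.+1%:R * form (P n.+1 t) (P n t)
     + Num.sqrt n%:R * form (P (n - 1)%N t) (P n t)) = 0.
Proof.
(* Antisymmetry makes the sum telescope; [F 0] vanishes through [sqrt 0] and [F NH] through the
   truncation. *)
pose F n := Num.sqrt n%:R * form (P n t) (P (n - 1)%N t).
have -> : \sum_(n < NH) (Num.sqrt n.+1%:R * form (P n.+1 t) (P n t)
     + Num.sqrt n%:R * form (P (n - 1)%N t) (P n t)) = \sum_(n < NH) (F n.+1 - F n).
  apply: eq_bigr => n _; rewrite /F subSS subn0.
  by rewrite (central_antisym _ _ _ mesh L_gt0 (P (n - 1)%N t)) mulrN.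
rewrite -(big_mkord xpredT (fun n => F n.+1 - F n)) telescope_sumr// /F sqrtr0 mul0r subr0.
have -> : P NH t = fun=> 0.
  by apply/funext => j; apply: curve_trunc.
by rewrite central0l mulr0.
Qed.

(** The square of the weighted norm. *)
Let modal_norm t : R := a t * \sum_(n < NH) int (fun j => P n t j * P n t j).

Let dmodal_norm t : R := ddt a t * \sum_(n < NH) int (fun j => P n t j * P n t j)
  + a t * \sum_(n < NH) (2 * int (fun j => dP n t j * P n t j)).

Let is_ddt_modes t : 0 <= t -> is_ddt (fun s => \sum_(n < NH) int (fun j => P n s j * P n s j)) t
  (\sum_(n < NH) (2 * int (fun j => dP n t j * P n t j))).
Proof.
move=> t0; apply: is_ddt_sum => n _.
have D := is_ddt_broken_intM _ _ _ _ mesh _ _ _ (C_C1 n) (C_C1 n) t0.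
have sym : int (fun j => P n t j * dP n t j) = int (fun j => dP n t j * P n t j).
  by apply: eq_broken_int => j _; rewrite mulrC.
rewrite sym -mulr2n -mulr_natl in D; exact: D.
Qed.

Lemma is_ddt_modal_norm t : 0 < t -> is_ddt modal_norm t (dmodal_norm t).
Proof.
move=> t0; apply: is_ddtM; last exact: is_ddt_modes (ltW t0).
by apply: is_ddt_ddt; exact: is_ddt_derivable (is_ddt_alpha t t0).
Qed.

Let X t n := int (fun j => (n%:R *: P n t j + Num.sqrt ((n%:R - 1) * n%:R) *: P (n - 2)%N t j) * P n t j).
Let Y t n := int (fun j => PE t j * P (n - 1)%N t j * P n t j).
Let M t n := int (fun j => P n t j * P n t j).

(** Each mode equation is tested with the mode itself and multiplied by [2 * a t]. *)
Lemma dmodal_norm_le_modal t : 0 < t -> dmodal_norm t <= \sum_(n < NH)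
  (ddt a t * M t n + 2 * ddt a t * X t n + 2 * a t ^+ 2 * Num.sqrt n%:R * Y t n).
Proof.
move=> t0; have at0 := alpha_gt0 t.
pose T n := Num.sqrt n.+1%:R * form (P n.+1 t) (P n t) + Num.sqrt n%:R * form (P (n - 1)%N t) (P n t).
have V (n : 'I_NH) : 2 * a t * int (fun j => dP n t j * P n t j)
    <= 2 * ddt a t * X t n + 2 * a t ^+ 2 * Num.sqrt n%:R * Y t n - 2 * T n.
  have := vlasov_weak n t _ (ltn_ord n) (ltW t0) (size_curve (C n) t).
  rewrite -/(X t n) -/(Y t n) -/(T n).
  (* The penalization is a sum of squared jumps here, nonnegative and dropped in the bound. *)
  set D := 2^-1 * delta _ _ _ _ _ _ _ _ * _.
  have D0 : 0 <= D.
    rewrite /D mulr_ge0//; last by apply: sumr_ge0 => j _; rewrite -expr2 sqr_ge0.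
    by rewrite mulr_ge0// /delta; case: ifP => // _; rewrite divr_ge0// ltW.
  clearbody D => H; have {H} -> : int (fun j => dP n t j * P n t j)
      = ddt a t / a t * X t n - (a t)^-1 * T n - D + a t * Num.sqrt n%:R * Y t n.
    by apply/eqP; rewrite -subr_eq0 -[X in _ == X]H; apply/eqP; ring.
  rewrite -subr_ge0 (_ : _ - _ = 2 * a t * D); first exact: mulr_ge0 (mulr_ge0 (ler0n _ 2) (ltW at0)) D0.
  by field; rewrite gt_eqF.
have -> : dmodal_norm t = \sum_(n < NH) (ddt a t * M t n + 2 * a t * int (fun j => dP n t j * P n t j)).
  by rewrite /dmodal_norm !mulr_sumr -big_split; apply: eq_bigr => n _ /=; rewrite /M; ring.
apply: (@le_trans _ _ (\sum_(n < NH) (ddt a t * M t n + (2 * ddt a t * X t n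
   + 2 * a t ^+ 2 * Num.sqrt n%:R * Y t n - 2 * T n)))).
  by apply: ler_sum => n _; rewrite lerD2l.
rewrite le_eqVlt; apply/orP; left; apply/eqP.
transitivity (\sum_(n < NH) (ddt a t * M t n + 2 * ddt a t * X t n
   + 2 * a t ^+ 2 * Num.sqrt n%:R * Y t n) - 2 * \sum_(n < NH) T n).
  by rewrite mulr_sumr -sumrB; apply: eq_bigr => n _; ring.
by rewrite transport_cancel mulr0 subr0.
Qed.

(** Both sides are gathered under a single integral, so that [modal_estimate] applies at each
    interior point with the local value of the field. *)
Lemma dmodal_norm_le t : 0 < t -> dmodal_norm t <= (2 * gamma)^-1 * modal_norm t.
Proof.
move=> t0; have at0 := alpha_gt0 t; apply: le_trans (dmodal_norm_le_modal t t0) _.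
pose W j := \sum_(n < NH) (ddt a t *: (P n t j * P n t j)
   + ((2 * ddt a t) *: ((n%:R *: P n t j + Num.sqrt ((n%:R - 1) * n%:R) *: P (n - 2)%N t j) * P n t j)
   + (2 * a t ^+ 2 * Num.sqrt n%:R) *: (PE t j * P (n - 1)%N t j * P n t j))).
pose V j := (a t / (2 * gamma)) *: \sum_(n < NH) (P n t j * P n t j).
have -> : \sum_(n < NH) (ddt a t * M t n + 2 * ddt a t * X t n + 2 * a t ^+ 2 * Num.sqrt n%:R * Y t n)
   = int W.
  by rewrite /W broken_int_sum; apply: eq_bigr => n _; rewrite !broken_intD !broken_intZ addrA.
have -> : (2 * gamma)^-1 * modal_norm t = int V.
  by rewrite /V broken_intZ broken_int_sum /modal_norm; ring.
rewrite -subr_ge0 (_ : int V - int W = int (fun j => V j + (-1) *: W j)); last first.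
  by rewrite broken_intD (broken_intZ _ _ _ W) mulN1r.
apply: broken_int_ge0 => j jN x xj.
have -> : (V j + -1 *: W j).[x] = (V j).[x] - (W j).[x].
  by rewrite hornerD scaleN1r hornerN.
rewrite subr_ge0 /W /V hornerZ !horner_sum.
have e_le : `|(PE t j).[x]| <= nE t.
  rewrite -(broken_curve _ _ (sol_E sol) (ltW t0) _ jN x xj).
  exact: supnorm_ub mesh L_gt0 _ _ _ ((sol_E sol).1 _ (ltW t0)) jN xj.
have c_trunc n : (NH <= n)%N -> (P n t j).[x] = 0.
  by move=> Nn; rewrite curve_trunc// horner0.
have H := modal_estimate NH (fun n => (P n t j).[x]) _ _ _ _ _ at0 gamma_gt0 e_le c_trunc
  (is_ddtE _ _ _ (ltW t0) (is_ddt_alpha t t0)).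
apply: le_trans (le_trans H _).
  rewrite le_eqVlt; apply/orP; left; apply/eqP; apply: eq_bigr => n _.
  by rewrite !(hornerD, hornerZ, hornerM); ring.
rewrite le_eqVlt; apply/orP; left; apply/eqP; congr (_ * _); apply: eq_bigr => n _.
by rewrite hornerM expr2.
Qed.

Lemma modal_norm_le t : 0 <= t -> modal_norm t <= modal_norm 0 * expR ((2 * gamma)^-1 * t).
Proof.
apply: (gronwall modal_norm dmodal_norm); [|exact: is_ddt_modal_norm|exact: dmodal_norm_le].
apply: cvgM; first exact: alpha_cvg0.
exact: is_ddt_continuous (is_ddt_modes 0 (lexx 0)).
Qed.

Lemma modal_norm_ge0 t : 0 <= modal_norm t.
Proof.
rewrite mulr_ge0 ?(ltW (alpha_gt0 t))//; apply: sumr_ge0 => n _; apply: broken_int_ge0 => j jN x xj.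
by rewrite hornerM -expr2 sqr_ge0.
Qed.

Lemma omega_normE t : 0 <= t ->
  omega_norm L (a t) (f_approx Nx xh NH alpha0 gamma C E t) = (modal_norm t `^ 2^-1)%:E.
Proof.
move=> t0; rewrite /f_approx (omega_norm_mesh _ _ _ _ _ (fun n => C n t) (fun n => P n t) mesh (alpha_gt0 t)).
  by rewrite /modal_norm; congr ((_ * _) `^ _)%:E; apply: eq_bigr => n _; apply: eq_bigr => j _; rewrite expr2.
by move=> n j jN; exact: broken_curve _ _ (C_C1 n) t0 _ jN.
Qed.

(** Taking the square root of the bound on [modal_norm] halves the rate [(2 * gamma)^-1]. *)
Lemma omega_norm_le t : 0 <= t ->
  (omega_norm L (a t) (f_approx Nx xh NH alpha0 gamma C E t)
   <= omega_norm L (a 0%R) (f_approx Nx xh NH alpha0 gamma C E 0%R)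
      * (expR (t / (4 * gamma))%R)%:E)%E.
Proof.
move=> t0; have E1 := omega_normE t t0; have E2 := omega_normE 0 (lexx 0).
rewrite [leLHS]E1 [X in (_ <= X * _)%E]E2 -EFinM lee_fin.
apply: (@le_trans _ _ ((modal_norm 0 * expR ((2 * gamma)^-1 * t)) `^ 2^-1)).
  by rewrite ge0_ler_powR// ?nnegrE ?modal_norm_ge0 ?modal_norm_le// mulr_ge0 ?modal_norm_ge0 ?expR_ge0.
rewrite powRM ?modal_norm_ge0 ?expR_ge0// -expRM ler_wpM2l ?powR_ge0// ler_expR.
rewrite le_eqVlt; apply/orP; left; apply/eqP; field.
by rewrite gt_eqF.
Qed.

End Conservation.

Theorem theorem3p4 (R : realType) (L alpha0 gamma beta : R)
    (Nx : nat) (xh : nat -> R) (NH k : nat)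
    (C : nat -> R -> R -> R) (E Phi : R -> R -> R) (rho0 : R -> R)
    (L_gt0 : 0 < L) (alpha0_gt0 : 0 < alpha0) (gamma_gt0 : 0 < gamma)
    (mesh : is_mesh L Nx xh)
    (beta_choice : exists2 c : R, 0 < c &
       beta = c \/ beta = c * (mesh_size Nx xh)^-1)
    (NH_ge3 : (3 <= NH)%N)
    (sol : dg_solution L Nx xh NH k alpha0 gamma beta C E Phi rho0) :
  let a := alpha Nx xh alpha0 gamma E in
  let f := f_approx Nx xh NH alpha0 gamma C E in
  let fnorm := fun t : R => omega_norm L (a t) (f t) in
  [/\ (forall t : R, 0 <= t ->
         time_derivable (mass L C) t /\ ddt (mass L C) t = 0),
      ((fnorm 0%R < +oo)%E ->
       forall t : R, 0 <= t ->
         (fnorm t <= fnorm 0%R * (expR (t / (4 * gamma))%R)%:E)%E)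
    & (forall t : R, 0 <= t ->
         total_energy L Nx xh alpha0 gamma beta C E Phi t
         = total_energy L Nx xh alpha0 gamma beta C E Phi 0)].
Proof.
move=> a f fnorm; split.
- move=> t t0; have D := is_ddt_mass _ _ _ _ _ _ _ _ _ _ _ _ L_gt0 mesh NH_ge3 sol t t0.
  by split; [exact: is_ddt_derivable D | exact: is_ddtE].
- move=> _ t t0.
  exact: (omega_norm_le _ _ _ _ _ _ _ _ _ _ _ _ L_gt0 mesh alpha0_gt0 gamma_gt0 sol).
- move=> t t0.
  exact: (energy_const _ _ _ _ _ _ _ _ _ _ _ _ L_gt0 mesh NH_ge3 alpha0_gt0 gamma_gt0 sol).
Qed.
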